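(* Let $n$ be a non-negative (time-global) entropy solution of $$\partial_t n+\partial_x F(x,n)=0,\quad F(x,n)=(2x-x^2)n-n^2,\qquad x>0,\ t>0,\qquad F(x,n)\to 0 \text{ as } x\to\infty,$$ with compactly supported initial data $n_0\in L^1([0,\infty))$. Then for every $T>0$, $$N[n(T,\cdot)]+\int_0^T n(t,0)^2\,dt=N[n_0],$$ where $N[f]=\int_0^\infty f(x)\,dx$.
   Context: Let $F(x,n)=(2x-x^2)n-n^2$ and write $F_x(x,k)=(2-2x)k$ for its partial derivative in $x$; $\operatorname{sign}(0)=0$. Entropy solution. A function $n(t,x)$ is an entropy solution of $\partial_t n+\partial_xF(x,n)=0$ on $x>0$, $t\in(0,T)$, with boundary condition $F(x,n)\to0$ as $x\to\infty$, if: (i) $n\in L^1([0,T]\times[0,\infty))\cap L^1([0,T];L^2([0,\infty)))$ and for every $\phi\in C_c^\infty((0,T)\times(0,\infty))$, $\int_0^T\int_0^\infty \big(n\,\partial_t\phi+F(x,n)\,\partial_x\phi\big)\,dx\,dt=0$; (ii) for every $k\in\mathbb{R}$ and every non-negative $\phi\in C_c^\infty((0,T)\times(0,\infty))$, $$\int_0^T\int_0^\infty\Big[|n-k|\,\partial_t\phi+\operatorname{sign}(n-k)\big(F(x,n)-F(x,k)\big)\partial_x\phi-\operatorname{sign}(n-k)F_x(x,k)\,\phi\Big]dx\,dt\ge0;$$ (iii) $\lim_{R\to\infty}\int_0^T|F(R,n(t,R))|\,dt=0$. It is time-global if this holds for every $T>0$. No boundary condition is imposed at $x=0$. Initial data $n_0$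 means: $n\in C([0,T];L^1((0,\infty)))$ (after modification on a null set of times) with $n(0,\cdot)=n_0$. The value $n(t,R)$ for $R>0$ is understood as a trace from $x<R$, and $n(t,0)$ as the trace from $x>0$. *)

(* Defs.v *)
From HB Require Import structures.
From mathcomp Require Import all_boot all_order all_algebra.
From mathcomp Require Import all_classical all_reals all_analysis.
Set Implicit Arguments.
Unset Strict Implicit.
Unset Printing Implicit Defensive.
Import Order.TTheory GRing.Theory Num.Theory.
Import numFieldNormedType.Exports.
Local Open Scope classical_set_scope.
Local Open Scope ring_scope.

(* Space-time points are pairs z = (t, x).  Functions of (t, x) that stand for
   Lebesgue classes are curried, n t x; test functions live on the normed
   module R * R, and 'D_(1, 0), 'D_(0, 1) are their t- and x-derivatives. *)

Section Kompaneets.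
Variable R : realType.
Local Notation mu := (@lebesgue_measure R).
Local Notation mu2 := (mu \x mu)%E.

Definition flux (x n : R) : R := (2 * x - x ^+ 2) * n - n ^+ 2.

Definition flux_x (x k : R) : R := (2 - 2 * x) * k.

Fixpoint is_Ck (k : nat) (f : R * R -> R) : Prop :=
  continuous f /\
  if k is k'.+1 then
    [/\ forall z, derivable f z (1, 0) /\ derivable f z (0, 1),
        is_Ck k' ('D_(1, 0) f) & is_Ck k' ('D_(0, 1) f)]
  else True.

Definition test_function (T : R) (phi : R * R -> R) : Prop :=
  [/\ forall k, is_Ck k phi,
      compact (closure [set z | phi z != 0]) &
      closure [set z | phi z != 0] `<=` `]0, T[ `*` `]0, +oo[].

(* The Lebesgue integral below is (integral of positive part) - (integral of
   negative part) in \bar R with +oo - +oo = -oo, so having integral 0 entails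
   integrability.  As this is required for every phi, F(x, n) is locally
   integrable on (0, T) x (0, oo), and hence all the integrands of
   [entropy_inequality] are integrable too. *)
Definition weak_solution (T : R) (n : R -> R -> R) : Prop :=
  forall phi, test_function T phi ->
    (\int[mu2]_(z in `]0%R, T[ `*` `]0%R, +oo[)
       (n z.1 z.2 * 'D_(1, 0) phi z
        + flux z.2 (n z.1 z.2) * 'D_(0, 1) phi z)%:E = 0)%E.

Definition entropy_inequality (T : R) (n : R -> R -> R) : Prop :=
  forall (k : R) phi, test_function T phi -> (forall z, 0 <= phi z) ->
    (0 <= \int[mu2]_(z in `]0%R, T[ `*` `]0%R, +oo[)
       (`|n z.1 z.2 - k| * 'D_(1, 0) phi z
        + Num.sg (n z.1 z.2 - k) * (flux z.2 (n z.1 z.2) - flux z.2 k)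
          * 'D_(0, 1) phi z
        - Num.sg (n z.1 z.2 - k) * flux_x z.2 k * phi z)%:E)%E.

(* Strong traces, in the L^1_loc(0, T) sense and in the averaged form that does
   not depend on the representative of n: g is the trace of n at x0 from the
   right if, for all 0 < a < b < T,
     1/h int_x0^(x0+h) int_a^b |n(t, x) - g(t)| dt dx -> 0  as h -> 0+.
   Such a g is unique up to a null set of times. *)
Definition right_trace (T : R) (n : R -> R -> R) (x0 : R) (g : R -> R) : Prop :=
  measurable_fun `]0, T[ g /\
  forall a b, 0 < a -> a < b -> b < T ->
    ((h^-1)%:E * \int[mu2]_(z in `]a, b[ `*` `]x0, (x0 + h)%R[)
       `|n z.1 z.2 - g z.1|%:E)%E @[h --> 0^'+] --> 0%E.

Definition left_trace (T : R) (n : R -> R -> R) (x0 : R) (g : R -> R) : Prop :=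
  measurable_fun `]0, T[ g /\
  forall a b, 0 < a -> a < b -> b < T ->
    ((h^-1)%:E * \int[mu2]_(z in `]a, b[ `*` `](x0 - h)%R, x0[)
       `|n z.1 z.2 - g z.1|%:E)%E @[h --> 0^'+] --> 0%E.

Definition no_flux_at_infinity (T : R) (n : R -> R -> R) : Prop :=
  exists tr : R -> R -> R,
    (forall r, 0 < r -> left_trace T n r (tr r)) /\
    (\int[mu]_(t in `[0%R, T]) `|flux r (tr r t)|%:E)%E @[r --> +oo] --> 0%E.

Definition entropy_solution (T : R) (n : R -> R -> R) : Prop :=
  [/\ mu2.-integrable (`[0, T] `*` `[0, +oo[) (fun z => (n z.1 z.2)%:E),
      (\int[mu]_(t in `[0%R, T])
         sqrte (\int[mu]_(x in `[0%R, +oo[) (n t x ^+ 2)%:E) < +oo)%E,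
      weak_solution T n,
      entropy_inequality T n &
      no_flux_at_infinity T n].

Definition global_entropy_solution (n : R -> R -> R) : Prop :=
  forall T, 0 < T -> entropy_solution T n.

Definition nonnegative (n : R -> R -> R) : Prop :=
  {ae mu2, forall z, 0 < z.1 -> 0 < z.2 -> 0 <= n z.1 z.2}.

(* m is a representative of n, equal to it for almost every time, with
   t |-> m t in C([0, oo); L^1(0, oo)). *)
Definition L1_continuous_version (n m : R -> R -> R) : Prop :=
  [/\ {ae mu, forall t, 0 < t -> {ae mu, forall x, 0 < x -> m t x = n t x}},
      forall t, 0 <= t -> mu.-integrable `]0, +oo[ (EFin \o m t) &
      forall t, 0 <= t ->
        (\int[mu]_(x in `]0%R, +oo[) `|m s x - m t x|%:E)%E
          @[s --> within `[0, +oo[ (nbhs t)] --> 0%E].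

Definition compactly_supported (f : R -> R) : Prop :=
  exists M : R, {ae mu, forall x, M < x -> f x = 0}.

Definition photon_number (f : R -> R) : \bar R :=
  (\int[mu]_(x in `[0%R, +oo[) (f x)%:E)%E.

End Kompaneets.

(* Main.v *)
(* Test the equation with theta(t) chi(x), where chi rises from 0 to 1 on (0, h)
   and falls back to 0 on (r, r + 1).  As h -> 0 and r -> oo, the flux at r
   vanishes: at almost every r the trace of n coincides with n(., r).  Hence the
   averages of theta n^2 with weight chi' near x = 0 converge to the integral of
   theta' n.  To identify this limit with the integral of theta g^2, the strong
   L^1 trace g only handles the truncations min(n^2, c^2); that no part of n^2
   concentrates at x = 0 follows from the entropy inequality with one large
   constant k: the outflow of (n - k)_+ through x = 0 is bounded by quantities
   that do not depend on h and tend to 0 as k -> oo.  Finally theta increases to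
   the indicator of (0, T), and the L^1 continuity in time gives the difference
   of the masses at times 0 and T. *)
Require Import Defs.
From mathcomp Require Import all_boot all_order all_algebra.
From mathcomp Require Import all_classical all_reals all_analysis.
From mathcomp Require Import measurable_realfun zify ring lra.
Import Order.TTheory GRing.Theory Num.Theory.
Import numFieldNormedType.Exports.
Local Open Scope classical_set_scope.
Local Open Scope ring_scope.

(** * Smooth functions *)

(** The obstacle is that n^2 has no uniform bound near x = 0. It is integrable against each fixed
    slope of a cutoff, because the weak formulation has a finite value, but the slopes have height
    up to C / h, and the trace controls n in L^1 only. The linear part (2x - x^2) n of the flux is
    harmless, since x <= h on the slope compensates its height. For the quadratic part, the entropy
    (n - k)_+ has flux (n - k)_+ ((2x - x^2) - n - k). As 2x - x^2 <= 1 <= k, this flux points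
    towards x = 0, and twice its modulus is at least n^2 - (2k)^2 where n > k. The source -F_x(x, k)
    = -(2 - 2x) k is a loss as long as x <= 1, which is why the cutoff of the entropy argument
    descends between 1/4 and 1. The other terms involve only the time slope, where n is integrable,
    and that descent, which stays away from x = 0. Fixed integrable functions dominate them, so they
    tend to 0 as k grows, uniformly in h. The limit h -> 0 is therefore taken first, at a fixed
    truncation level, and k -> oo afterwards. *)

Section smooth_functions.
Context {R : realType}.
Implicit Types (f g : R -> R) (k : nat).

Fixpoint smooth_upto k f : Prop :=
  if k is k'.+1 then (forall x, derivable f x 1) /\ smooth_upto k' ((derive1 f))
  else continuous f.

Definition smooth f := forall k, smooth_upto k f.

Lemma derivable_cont f : (forall x, derivable f x 1) -> continuous f.
Proof. by move=> df x; apply/differentiable_continuous/derivable1_diffP. Qed.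

Lemma smooth_uptoS k f : smooth_upto k.+1 f -> smooth_upto k f.
Proof.
elim: k f => [|k IH] f /=; first by case=> df _; exact: derivable_cont.
by case=> df [df' sf']; split=> //; exact: IH.
Qed.

Lemma smooth_derivable {f} : smooth f -> forall x, derivable f x 1.
Proof. by move=> /(_ 1%N)[]. Qed.

Lemma smooth_continuous {f} : smooth f -> continuous f.
Proof. by move=> /(_ 0%N). Qed.

Lemma smooth_derive1 f : smooth f -> smooth (derive1 f).
Proof. by move=> sf k; have [] := sf k.+1. Qed.

(** A coinduction principle. It suits families described by parameters, such as polynomials, where
    differentiation only changes the parameter. *)
Lemma smooth_ind (P : (R -> R) -> Prop) :
  (forall f, P f -> (forall x, derivable f x 1) /\ P (derive1 f)) ->
  forall f, P f -> smooth f.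
Proof.
move=> HP f Pf k; elim: k f Pf => [|k IH] f Pf.
  by apply: derivable_cont; have [] := HP f Pf.
by have [df Pf'] := HP f Pf; split=> //; exact: IH.
Qed.

Lemma derive1_ext f f' : (forall x : R, is_derive x 1 f (f' x)) -> (derive1 f) = f'.
Proof. by move=> h; apply/funext => x; rewrite derive1E derive_val. Qed.

Lemma smooth_cst c : smooth (fun=> c).
Proof.
apply: (@smooth_ind (fun f => exists c, f = fun=> c)); last by exists c.
move=> _ [{}c ->]; split=> [x|]; first exact: derivable_cst.
by exists 0; apply: derive1_ext => x; exact: is_derive_cst.
Qed.

Lemma smooth_horner (p : {poly R}) : smooth (horner p).
Proof.
apply: (@smooth_ind (fun f => exists p, f = horner p)); last by exists p.
move=> _ [{}p ->]; split=> [x|]; first exact: derivable_horner.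
by exists p^`(); rewrite derivE.
Qed.

Lemma smooth_uptoD k f g :
  smooth_upto k f -> smooth_upto k g -> smooth_upto k (f \+ g).
Proof.
elim: k f g => [|k IH] f g; first by move=> cf cg x; exact: continuousD (cf x) (cg x).
move=> [df sf'] [dg sg']; split=> [x|]; first exact: derivableD.
rewrite (_ : derive1 (f \+ g) = (derive1 f) \+ (derive1 g)); first exact: IH.
by apply/funext => x; rewrite /= !derive1E; exact: deriveD (df x) (dg x).
Qed.

Lemma smooth_uptoM k f g :
  smooth_upto k f -> smooth_upto k g -> smooth_upto k (f \* g).
Proof.
elim: k f g => [|k IH] f g; first by move=> cf cg x; exact: continuousM (cf x) (cg x).
move=> sf sg; have [df sf'] := sf; have [dg sg'] := sg.
split=> [x|]; first exact: derivableM.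
rewrite (_ : derive1 (f \* g) = ((derive1 f) \* g) \+ (f \* (derive1 g))).
  by apply: smooth_uptoD; apply: IH => //; exact: smooth_uptoS.
by apply/funext => x; rewrite /= !derive1E (deriveM (df x) (dg x)) addrC; congr +%R;
  rewrite mulrC.
Qed.

Lemma smooth_uptoV k f : (forall x, f x != 0) ->
  smooth_upto k f -> smooth_upto k (fun x => (f x)^-1).
Proof.
move=> f0; elim: k => [|k IH]; first by move=> cf x; exact: continuousV (f0 x) (cf x).
move=> sf; have [df sf'] := sf; split=> [x|]; first exact: derivableV.
have := IH (smooth_uptoS _ _ sf) => sV.
(* The derivative -f' / f^2 is expressed through the inverse itself, whose smoothness up to order k
   is the induction hypothesis. *)
rewrite (_ : derive1 _ = (cst (-1) \* (derive1 f)) \* ((fun x => (f x)^-1) \* (fun x =>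
  (f x)^-1))).
  by apply: smooth_uptoM; apply: smooth_uptoM => //; exact: smooth_cst.
apply/funext => x; rewrite !derive1E deriveV//= /GRing.scale/= -derive1E.
by rewrite expr2 invfM; ring.
Qed.

Lemma smoothD f g : smooth f -> smooth g -> smooth (f \+ g).
Proof. by move=> sf sg k; exact: smooth_uptoD. Qed.

Lemma smoothM f g : smooth f -> smooth g -> smooth (f \* g).
Proof. by move=> sf sg k; exact: smooth_uptoM. Qed.

Lemma smoothV f : (forall x, f x != 0) -> smooth f -> smooth (fun x => (f x)^-1).
Proof. by move=> f0 sf k; exact: smooth_uptoV. Qed.

Lemma is_derive_affine f (a b x : R) : derivable f (a * x + b) 1 ->
  is_derive x 1 (fun y => f (a * y + b)) (a * (derive1 f) (a * x + b)).
Proof.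
move=> df.
have dl : is_derive x 1 (fun y : R => a * y + b) a.
  have -> : (fun y : R => a * y + b) = (a *: id) \+ cst b by apply/funext.
  by apply: is_derive_eq; rewrite addr0 /GRing.scale/= mulr1.
have dF : is_derive (a * x + b) 1 f (derive1 f (a * x + b)).
  by rewrite derive1E; exact: derivableP.
by rewrite mulrC; exact: (@is_derive1_comp _ f (fun y => a * y + b) _ _ _ dF dl).
Qed.

Lemma smooth_affine f (a b : R) : smooth f -> smooth (fun x => f (a * x + b)).
Proof.
(* Each differentiation produces a factor a; the free constant c absorbs it, which makes the class
   stable. *)
move=> sf; pose P u := exists c g, smooth g /\ u = fun x => c * g (a * x + b).
apply: (@smooth_ind P); last by exists 1, f; split=> //; apply/funext => x; rewrite mul1r.
move=> _ [c [g [sg ->]]].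
have H (x : R) : is_derive x 1 (fun x => c * g (a * x + b)) (c * (a * (derive1 g) (a * x + b))).
  by apply: is_deriveZ; apply: is_derive_affine; exact: smooth_derivable.
split=> [x|]; first exact: (@ex_derive _ _ _ _ _ _ _ (H x)).
exists (c * a), (derive1 g); split; first exact: smooth_derive1.
by apply: derive1_ext => x; rewrite -mulrA; exact: H.
Qed.

(** Termwise, from y^i / i! <= exp y. This is how exp (-1/x) beats every power of 1/x at the
    origin. *)
Lemma poly_le_expR (p : {poly R}) :
  exists C : R, forall y, 0 <= y -> `|p.[y]| <= C * expR y.
Proof.
exists (\sum_(i < size p) `|p`_i| * i`!%:R) => y y0.
rewrite horner_coef mulr_suml (le_trans (ler_norm_sum _ _ _))//.
apply: ler_sum => i _; rewrite normrM -mulrA ler_wpM2l// normrX (ger0_norm y0).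
case: (i : nat) => [|m].
  by rewrite expr0 fact0 mul1r; have := expR_ge1Dx y; lra.
rewrite -ler_pdivrMl ?ltr0n ?fact_gt0// mulrC.
by apply: le_trans (expR_ge1Dxn m y0); rewrite lerDr.
Qed.

(* The functions [p(1/x) exp(-1/x)], extended by 0 to [x <= 0], are closed under
   differentiation, hence smooth. *)
Definition flat (p : {poly R}) (x : R) : R :=
  if 0 < x then p.[x^-1] * expR (- x^-1) else 0.

Lemma is_derive_flat (p : {poly R}) (x : R) :
  is_derive x (1 : R) (flat p) (flat ('X^2 * (p - p^`())) x).
Proof.
have [x0|x0|x0] := ltgtP 0 x; last rewrite -x0.
- have H : is_derive x 1 (fun y : R => p.[y^-1] * expR (- y^-1))
      (flat ('X^2 * (p - p^`())) x).
    have xn0 : x != 0 by rewrite gt_eqF.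
    pose iv : R -> R := fun y => y^-1.
    have div : is_derive x 1 iv (- x ^- 2).
      have dV : derivable iv x 1 by apply: (@derivableV _ _ id).
      apply: DeriveDef => //.
      rewrite /iv (@deriveV _ _ id)// derive_id /GRing.scale/= mulr1//.
    have dp : is_derive x 1 (fun y : R => p.[y^-1]) (p^`().[x^-1] * - x ^- 2).
      exact: (@is_derive1_comp _ (horner p) iv _ _ _ (is_derive_poly p (iv x)) div).
    have de : is_derive x 1 (fun y : R => expR (- y^-1)) (expR (- x^-1) * x ^- 2).
      have d1 : is_derive x 1 (- iv) (x ^- 2).
        by apply: is_derive_eq; rewrite opprK.
      exact: (@is_derive1_comp _ (@expR R) (- iv) _ _ _ (is_derive_expR (- iv x)) d1).
    refine (is_derive_eq (is_deriveM dp de) _); rewrite /flat x0 /GRing.scale/=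
      !hornerE/= exprVn.
    by ring.
  apply: near_eq_is_derive H.
  near=> y; rewrite /flat ifT//.
  near: y; exact: lt_nbhsr.
- rewrite /flat ifF; last by apply/negbTE; rewrite -leNgt ltW.
  apply: (@near_eq_is_derive _ _ _ (cst 0)) => //.
  near=> y; rewrite /= ifF//; apply/negbTE; rewrite -leNgt ltW//.
  near: y; exact: lt_nbhsl.
(* With y = 1/h, the quotient p(y) e^(-y) / h equals h (y^2 p(y)) e^(-y): one extra power of y pays
   for the division by h, the other leaves a factor h that tends to 0. *)
- have [C HC] := poly_le_expR ('X^2 * p).
  rewrite [X in is_derive _ _ _ X]/flat ltxx.
  have C0 : 0 <= C.
    by have := HC 0 (lexx 0); rewrite expR0 mulr1; apply: le_trans.
  have bnd h : h != 0 -> `|h^-1 * flat p h| <= C * `|h|.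
    move=> h0; rewrite /flat; case: ifPn => [hp|_]; last first.
      by rewrite mulr0 normr0 mulr_ge0.
    have hV : 0 <= h^-1 by rewrite invr_ge0 ltW.
    have := HC _ hV; rewrite !hornerE/= !normrM => H1.
    rewrite (ger0_norm (expR_ge0 _)) (gtr0_norm hp) (ger0_norm hV).
    have EF := expRxMexpNx_1 h^-1.
    set F := expR (- h^-1) in EF *; set E := expR h^-1 in EF H1.
    have F0 : 0 <= F by exact: expR_ge0.
    rewrite !(ger0_norm hV) in H1.
    have -> : h^-1 * `|p.[h^-1]| * F = h * F * (h^-1 * h^-1 * `|p.[h^-1]|).
      by field.
    have -> : C * h = h * F * (C * E) by rewrite -[LHS]mul1r -EF; ring.
    by apply: ler_wpM2l => //; rewrite mulr_ge0// ltW.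
  have cv : h^-1 *: (flat p (h *: (1 : R) + 0) - flat p 0) @[h --> 0^'] --> (0 : R).
    apply/cvgr0Pnorm_le => e e0; near=> h.
    have h0 : h != 0 by near: h; exact: nbhs_dnbhs_neq.
    rewrite [X in _ - X]/flat ltxx subr0 addr0 /GRing.scale/= mulr1.
    apply: (le_trans (bnd h h0)).
    have : `|h| <= e / (C + 1).
      by near: h; apply: dnbhs0_le; rewrite divr_gt0// ltr_wpDl.
    rewrite ler_pdivlMr ?ltr_wpDl// => H1; apply: le_trans H1.
    by rewrite mulrDr mulr1 mulrC lerDl.
  apply: DeriveDef; first by apply/cvg_ex; exists 0; exact: cv.
  by apply/cvg_lim => //; exact: cv.
Unshelve. all: by end_near. Qed.

End smooth_functions.

(** * A smooth step function *)

Section smooth_step.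
Context {R : realType}.
Implicit Types (x y : R).

(** The flat margin up to 1/4 is quantitative on purpose. A rise of width h then vanishes for x <= h
    / 4, which keeps cutoffs compactly supported in x > 0, and a descent starting at 1/4 is over at
    x = 1, where [flux_x] changes sign. *)
Definition step_function (S : R -> R) (C : R) :=
  [/\ smooth S, {homo S : x y / x <= y}, forall x, 0 <= S x <= 1,
      forall x, x <= 4^-1 -> S x = 0 /\ derive1 S x = 0 &
      (forall x, 1 <= x -> S x = 1 /\ derive1 S x = 0) /\
      forall x, 0 <= derive1 S x <= C].

Let e := @flat R 1.

Let e_ge0 x : 0 <= e x.
Proof. by rewrite /e /flat; case: ifP => // _; rewrite hornerC mul1r expR_ge0. Qed.

Let e_gt0 x : 0 < x -> 0 < e x.
Proof. by move=> x0; rewrite /e /flat x0 hornerC mul1r expR_gt0. Qed.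

Let e_eq0 x : x <= 0 -> e x = 0.
Proof. by move=> x0; rewrite /e /flat ltNge x0. Qed.

Let e_homo : {homo e : x y / x <= y}.
Proof.
move=> x y xy; have [x0|x0] := leP x 0; first by rewrite (e_eq0 _ x0).
have y0 := lt_le_trans x0 xy.
by rewrite /e /flat x0 y0 !hornerC !mul1r ler_expR lerN2 lef_pV2.
Qed.

Lemma smooth_flat (p : {poly R}) : smooth (flat p).
Proof.
apply: (@smooth_ind _ (fun f => exists p, f = flat p)); last by exists p.
move=> _ [{}p ->]; split=> [x|].
  exact: (@ex_derive _ _ _ _ _ _ _ (is_derive_flat p x)).
by exists ('X^2 * (p - p^`())); apply: derive1_ext => x; exact: is_derive_flat.
Qed.

Lemma step_function_exists : exists S C, step_function S C.
Proof.
(* The classical quotient u / (u + v) with e = exp (-1/x) for x > 0: u is positive for x > 1/2 and v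
   for x < 3/4, so the denominator never vanishes. The transition lies in [1/2, 3/4], strictly
   inside [1/4, 1], hence the derivative vanishes outside by local constancy. *)
pose u x := e (1 * x + - 2^-1); pose v x := e (-1 * x + 3 / 4).
have uv0 x : 0 < u x + v x.
  have [x1|x1] := ltP (2^-1) x.
    by rewrite ltr_wpDr ?e_ge0// e_gt0//; lra.
  by rewrite ltr_wpDl ?e_ge0// e_gt0//; lra.
have su : smooth u by apply: smooth_affine; exact: smooth_flat.
have sv : smooth v by apply: smooth_affine; exact: smooth_flat.
pose S := u \* (fun x => ((u \+ v) x)^-1).
have sS : smooth S.
  apply: smoothM => //; apply: smoothV; last exact: smoothD.
  by move=> x /=; rewrite gt_eqF.
have S01 x : 0 <= S x <= 1.
  rewrite /S/= mulr_ge0 ?e_ge0 ?invr_ge0 ?(ltW (uv0 x))//=.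
  by rewrite ler_pdivrMr// mul1r lerDl e_ge0.
have S0 x : x <= 2^-1 -> S x = 0.
  by move=> x1; rewrite /S/= /u e_eq0 ?mul0r//; lra.
have S1 x : 3 / 4 <= x -> S x = 1.
  move=> x1; have v0 : v x = 0 by rewrite /v e_eq0//; lra.
  by rewrite /S/= v0 addr0 mulfV// gt_eqF//; have := uv0 x; rewrite v0 addr0.
have Smono : {homo S : x y / x <= y}.
  move=> x y xy; rewrite /S/= ler_pdivrMr// mulrAC ler_pdivlMr//.
  have h1 : u x <= u y by apply: e_homo; lra.
  have h2 : v y <= v x by apply: e_homo; lra.
  rewrite !mulrDr (mulrC (u x) (u y)) lerD2l.
  by apply: ler_pM => //; exact: e_ge0.
have S'0 x : x <= 4^-1 -> derive1 S x = 0.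
  move=> x1; have H : is_derive x 1 (cst (0:R)) 0 by exact: is_derive_cst.
  rewrite derive1E; apply: derive_val; apply: near_eq_is_derive H.
  near=> y; rewrite S0//=; apply/ltW; near: y; apply: lt_nbhsl; lra.
have S'1 x : 1 <= x -> derive1 S x = 0.
  move=> x1; have H : is_derive x 1 (cst (1:R)) 0 by exact: is_derive_cst.
  rewrite derive1E; apply: derive_val; apply: near_eq_is_derive H.
  near=> y; rewrite S1//=; apply/ltW; near: y; apply: lt_nbhsr; lra.
have S'ge0 x : 0 <= derive1 S x.
  rewrite derive1E; apply: limr_ge; first exact: smooth_derivable.
  near=> h; rewrite /GRing.scale/= mulr1.
  have [h0|h0] := leP 0 h.
    by rewrite mulr_ge0 ?invr_ge0// subr_ge0 Smono// lerDr.
  by apply: mulr_le0; rewrite ?subr_le0 ?Smono ?invr_le0 ?gerDr// ltW.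
(* The derivative vanishes outside [1/4, 1], so its maximum over [0, 1] bounds it everywhere. *)
have [c _ Hc] := @EVT_max R (derive1 S) 0 1 ler01 (continuous_subspaceT
  (smooth_continuous (smooth_derive1 _ sS))).
exists S, (derive1 S c); split => //.
  by move=> x x1; split; [apply: S0; lra | exact: S'0].
split.
  by move=> x x1; split; [apply: S1; lra | exact: S'1].
move=> x; rewrite S'ge0/=.
have [x0|x0] := leP x 4^-1; first by rewrite S'0// S'ge0.
have [x1|x1] := leP 1 x; first by rewrite S'1// S'ge0.
by apply: Hc; rewrite in_itv/=; lra.
Unshelve. all: by end_near. Qed.

End smooth_step.

(** * Tensor products as test functions *)

Section test_functions.
Context {R : realType}.
Implicit Types (th ch : R -> R).

Lemma derive_tensor_t th ch (z : R * R) : derivable th z.1 1 ->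
  is_derive z (1, 0) (fun z : R * R => th z.1 * ch z.2) (derive1 th z.1 * ch z.2).
Proof.
move=> dth; have dF : is_derive z.1 1 (fun t => th t * ch z.2) (derive1 th z.1 * ch z.2).
  have H : is_derive z.1 1 th (derive1 th z.1) by rewrite derive1E; exact: derivableP.
  by refine (is_derive_eq (is_deriveM H (is_derive_cst (ch z.2) z.1 1)) _);
    rewrite /GRing.scale/= mulr0 add0r mulrC.
have E : (fun h : R => h^-1 *: (th (h *: (1, 0) + z).1 * ch (h *: ((1, 0) : R * R) + z).2
     - th z.1 * ch z.2)) = (fun h : R => h^-1 *: (th (h *: 1 + z.1) * ch z.2 - th z.1 *
       ch z.2)).
  by apply/funext => h /=; rewrite scaler0 add0r.
case: dF => [d1 d2]; apply: DeriveDef.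
  by rewrite /derivable /= E; exact: d1.
by rewrite /derive /= E; exact: d2.
Qed.

Lemma derive_tensor_x th ch (z : R * R) : derivable ch z.2 1 ->
  is_derive z (0, 1) (fun z : R * R => th z.1 * ch z.2) (th z.1 * derive1 ch z.2).
Proof.
move=> dch; have dF : is_derive z.2 1 (fun x => th z.1 * ch x) (th z.1 * derive1 ch z.2).
  have H : is_derive z.2 1 ch (derive1 ch z.2) by rewrite derive1E; exact: derivableP.
  exact: is_deriveZ.
have E : (fun h : R => h^-1 *: (th (h *: (0, 1) + z).1 * ch (h *: ((0, 1) : R * R) + z).2
     - th z.1 * ch z.2)) = (fun h : R => h^-1 *: (th z.1 * ch (h *: 1 + z.2) - th z.1 *
       ch z.2)).
  by apply/funext => h /=; rewrite scaler0 add0r.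
case: dF => [d1 d2]; apply: DeriveDef.
  by rewrite /derivable /= E; exact: d1.
by rewrite /derive /= E; exact: d2.
Qed.

Lemma is_Ck_tensor k th ch : smooth th -> smooth ch ->
  is_Ck k (fun z => th z.1 * ch z.2).
Proof.
have cont th' ch' : smooth th' -> smooth ch' ->
    continuous (fun z : R * R => th' z.1 * ch' z.2).
  move=> /smooth_continuous ct /smooth_continuous cc z.
  apply: continuousM; apply: continuous_comp.
  - exact: cvg_fst.
  - exact: ct.
  - exact: cvg_snd.
  - exact: cc.
elim: k th ch => [|k IH] th ch sth sch; split; [exact: cont|by []|exact: cont|].
have Dt := fun z => derive_tensor_t th ch z (smooth_derivable sth _).
have Dx := fun z => derive_tensor_x th ch z (smooth_derivable sch _).
split.
- by move=> z; split; [exact: (@ex_derive _ _ _ _ _ _ _ (Dt z))|exact: (@ex_derive _ _ _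
  _ _ _ _ (Dx z))].
- rewrite (_ : 'D_(1, 0) (fun z : R * R => th z.1 * ch z.2) = fun z => derive1 th z.1 * ch z.2).
    by apply: IH => //; exact: smooth_derive1.
  by apply/funext => z; exact: (@derive_val _ _ _ _ _ _ _ (Dt z)).
- rewrite (_ : 'D_(0, 1) (fun z : R * R => th z.1 * ch z.2) = fun z => th z.1 * derive1 ch z.2).
    by apply: IH => //; exact: smooth_derive1.
  by apply/funext => z; exact: (@derive_val _ _ _ _ _ _ _ (Dx z)).
Qed.

Lemma test_function_tensor (T a b c d : R) th ch :
  smooth th -> smooth ch -> 0 < a -> b < T -> 0 < c ->
  (forall t, th t != 0 -> a <= t <= b) -> (forall x, ch x != 0 -> c <= x <= d) ->
  test_function T (fun z => th z.1 * ch z.2).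
Proof.
move=> sth sch a0 bT c0 hth hch.
have clK : closed ((`[a, b] `*` `[c, d]) : set (R * R)).
  rewrite (_ : _ `*` _ = (fst @^-1` `[a, b] `&` snd @^-1` `[c, d])%classic)//.
  apply: closedI.
    by apply: (@closed_comp _ _ fst) => [z _|]; [exact: cvg_fst|exact: interval_closed].
  by apply: (@closed_comp _ _ snd) => [z _|]; [exact: cvg_snd|exact: interval_closed].
have sub : closure [set z : R * R | th z.1 * ch z.2 != 0] `<=` `[a, b] `*` `[c, d].
  rewrite [X in _ `<=` X](closure_id _).1//; apply: closureS => z /=.
  by rewrite mulf_eq0 negb_or => /andP[/hth + /hch]; rewrite !in_itv.
split; first by move=> k; exact: is_Ck_tensor.
  apply: subclosed_compact sub; first exact: closed_closure.
  by apply: compact_setX; exact: segment_compact.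
apply: subset_trans sub _ => z [] /=; rewrite !in_itv/= => /andP[az zb] /andP[cz _].
by rewrite (lt_le_trans a0 az) (le_lt_trans zb bT) (lt_le_trans c0 cz).
Qed.

End test_functions.

(** * Integration *)

Section integration.
Context {d} {X : measurableType d} {R : realType} {m : {measure set X -> \bar R}}.
Implicit Types (u v : X -> R).

Lemma integrable_le {u v} : m.-integrable setT (EFin \o v) ->
  measurable_fun setT u -> (forall x, `|u x| <= v x) ->
  m.-integrable setT (EFin \o u).
Proof.
move=> iv mu uv; apply: le_integrable iv => //; first exact/measurable_EFinP.
by move=> x _; rewrite /= lee_fin (le_trans (uv x))// ler_norm.
Qed.

Lemma integral_Rintegral {u} : m.-integrable setT (EFin \o u) ->
  (\int[m]_x (u x)%:E = (\int[m]_x u x)%:E)%E.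
Proof. by move=> iu; rewrite /Rintegral fineK//; exact: integrable_fin_num. Qed.

Lemma dominated_Rintegral {u : nat -> X -> R} {u0 v} :
  (forall j, measurable_fun setT (u j)) -> measurable_fun setT u0 ->
  (forall x, u j x @[j --> \oo] --> u0 x) ->
  m.-integrable setT (EFin \o v) -> (forall j x, `|u j x| <= v x) ->
  \int[m]_x u j x @[j --> \oo] --> \int[m]_x u0 x.
Proof.
move=> mu mu0 uu0 iv uv.
have [||||| i0 _ H] := @dominated_convergence _ _ _ m setT measurableT
  (fun j => EFin \o u j) (EFin \o u0) (EFin \o v).
- by move=> j; exact/measurable_EFinP.
- exact/measurable_EFinP.
- by apply: aeW => x _; apply: cvg_EFin; [exact: nearW|exact: uu0].
- exact: iv.
- by apply: aeW => x j _; rewrite /= lee_fin.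
- apply: fine_cvg; rewrite fineK; first exact: H.
  exact: (integrable_fin_num _ i0).
Qed.

(* The library sets [+oo - +oo = -oo], so a finite integral forces both the
   positive and the negative part to be integrable. *)
Lemma fin_num_integrable {u} : measurable_fun setT u ->
  (\int[m]_x (u x)%:E \is a fin_num)%E -> m.-integrable setT (EFin \o u).
Proof.
move=> mu; have mEu : measurable_fun setT (EFin \o u) by exact/measurable_EFinP.
move=> h; apply/integrableP; split => //.
by rewrite (integral_fin_num_abs m measurableT mu).
Qed.

End integration.

Lemma measurable_sgr {R : realType} : measurable_fun setT (@Num.sg R).
Proof.
have -> : @Num.sg R = \1_(`]0, +oo[) \- \1_(`]-oo, 0[).
  apply/funext => y; rewrite /= !indicE !mem_setE !in_itv/= andbT.
  have [y0|y0|->] := ltgtP y 0.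
  - by rewrite ltr0_sg// sub0r.
  - by rewrite gtr0_sg// subr0.
  - by rewrite sgr0 subr0.
by apply: measurable_funB; exact: measurable_indic.
Qed.

Section integrals_of_derivatives.
Context {R : realType}.
Local Notation mu := (@lebesgue_measure R).
Local Notation mu2 := (mu \x mu)%E.
Implicit Types (u v : R -> R).

Lemma smooth_measurable u : smooth u -> measurable_fun setT u.
Proof. by move=> /smooth_continuous/continuous_measurable_fun. Qed.

Lemma continuous_supp_integrable u (a b : R) : continuous u ->
  (forall x, ~~ (a <= x <= b) -> u x = 0) -> mu.-integrable setT (EFin \o u).
Proof.
move=> cu u0; have cu' : {within `[a, b], continuous u} by exact: continuous_subspaceT.
have -> : u = u \_ `[a, b].
  apply/funext => x; rewrite patchE; case: ifPn => //.
  by rewrite notin_setE/= in_itv/= => /negP/u0.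
rewrite -restrict_EFin; apply/integrable_restrict => //=; rewrite setTI.
by apply: continuous_compact_integrable => //; exact: segment_compact.
Qed.

Lemma integral_derive1 u (a b : R) : a < b -> smooth u ->
  (forall x, ~~ (a <= x <= b) -> derive1 u x = 0) ->
  mu.-integrable setT (EFin \o derive1 u) /\
  \int[mu]_x derive1 u x = u b - u a.
Proof.
move=> ab su u0; have su' := smooth_derive1 _ su.
have cu' : {within `[a, b], continuous derive1 u}.
  exact/continuous_subspaceT/smooth_continuous.
have E : derive1 u = derive1 u \_ `[a, b].
  apply/funext => x; rewrite patchE; case: ifPn => //.
  by rewrite notin_setE/= in_itv/= => /negP/u0.
split; first exact: (continuous_supp_integrable _ a b (smooth_continuous su')).
have -> : \int[mu]_x derive1 u x = \int[mu]_(x in `[a, b]) derive1 u x.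
  by rewrite [RHS]Rintegral_mkcond {1}E.
rewrite /Rintegral (continuous_FTC2 ab cu' (F := u))//=.
have cu := smooth_continuous su.
split; first by move=> x _; exact: smooth_derivable.
- by apply: cvg_at_right_filter; exact: cu.
- by apply: cvg_at_left_filter; exact: cu.
Qed.

Lemma integrable_tensor u v :
  mu.-integrable setT (EFin \o u) -> mu.-integrable setT (EFin \o v) ->
  mu2.-integrable setT (EFin \o (fun z => u z.1 * v z.2)).
Proof.
move=> iu iv.
have mu_ : measurable_fun setT u by apply/measurable_EFinP; exact: measurable_int iu.
have mv_ : measurable_fun setT v by apply/measurable_EFinP; exact: measurable_int iv.
have mw : measurable_fun setT (fun z : R * R => (u z.1 * v z.2)%:E).
  apply/measurable_EFinP; apply: measurable_funM.
    exact: (measurableT_comp mu_ (@measurable_fst _ _ _ _)).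
  exact: (measurableT_comp mv_ (@measurable_snd _ _ _ _)).
apply/(integrable12ltyP mu mu mw) => /=.
have -> : (fun x => \int[mu]_y `|(u x * v y)%:E|)%E =
    (fun x => `|(u x)%:E| * \int[mu]_y `|(v y)%:E|)%E.
  apply/funext => x; rewrite -ge0_integralZl//; last first.
    by apply: measurableT_comp => //; exact/measurable_EFinP.
  by apply: eq_integral => y _; rewrite EFinM abseM.
rewrite ge0_integralZr//; last 2 first.
- by apply: measurableT_comp => //; exact/measurable_EFinP.
- exact: integral_ge0.
have /integrableP[_ u1] := iu; have /integrableP[_ v1] := iv.
by apply: lte_mul_pinfty => //; [exact: integral_ge0 | rewrite ge0_fin_numE//; exact:
  integral_ge0].
Qed.

Lemma Rintegral_tensor u v :
  mu.-integrable setT (EFin \o u) -> mu.-integrable setT (EFin \o v) ->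
  \int[mu2]_z (u z.1 * v z.2) = \int[mu]_x u x * \int[mu]_x v x.
Proof.
move=> iu iv; have iw := integrable_tensor _ _ iu iv.
rewrite {1}/Rintegral -(integral12_prod_meas1 iw)/= /fubini_F/=.
have -> : (fun x => \int[mu]_y (u x * v y)%:E)%E =
    (fun x => (u x * \int[mu]_y v y)%:E)%E.
  apply/funext => x; rewrite EFinM -integral_Rintegral// -integralZl//.
rewrite -/(Rintegral _ _ _) RintegralZr//.
Qed.

End integrals_of_derivatives.

(** * Cutoffs *)

Section cutoffs.
Context {R : realType}.
Local Notation mu := (@lebesgue_measure R).
Variables (S : R -> R) (C : R).
Hypothesis HS : step_function S C.
Implicit Types (h r x : R).

(* [rise h] climbs from 0 to 1 on [0, h], [fall r] descends from 1 to 0 on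
   [r, r + 1]; [rise'] and [fall'] are the absolute values of their slopes. *)
Definition rise h x := S (h^-1 * x).
Definition rise' h x := h^-1 * derive1 S (h^-1 * x).
Definition fall r x := S (r + 1 - x).
Definition fall' r x := derive1 S (r + 1 - x).
Definition cutoff h r x := rise h x * fall r x.

Lemma step_slope_ge0 : 0 <= C.
Proof. by case: HS => _ _ _ _ [_ /(_ 0) /andP[]]; exact: le_trans. Qed.

Lemma step_smooth : smooth S. Proof. by case: HS. Qed.

Lemma step_derivable x : derivable S x 1.
Proof. by apply: smooth_derivable; exact: step_smooth. Qed.

Lemma step0 x : x <= 4^-1 -> S x = 0 /\ derive1 S x = 0.
Proof. by case: HS => _ _ _ + _; exact. Qed.

Lemma step1 x : 1 <= x -> S x = 1 /\ derive1 S x = 0.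
Proof. by case: HS => _ _ _ _ [+ _]; exact. Qed.

Lemma step01 x : 0 <= S x <= 1. Proof. by case: HS. Qed.

Lemma riseE h : rise h = fun x => S (h^-1 * x + 0).
Proof. by apply/funext => x; rewrite addr0. Qed.

Lemma smooth_rise h : smooth (rise h).
Proof. by rewrite riseE; apply: smooth_affine; exact: step_smooth. Qed.

Lemma is_derive_rise h x : is_derive x 1 (rise h) (rise' h x).
Proof.
rewrite riseE (_ : rise' h x = h^-1 * derive1 S (h^-1 * x + 0)); last by rewrite addr0.
exact: is_derive_affine S h^-1 0 x (step_derivable _).
Qed.

Lemma derive1_rise h : derive1 (rise h) = rise' h.
Proof. by apply: derive1_ext => x; exact: is_derive_rise. Qed.

Lemma fallE r : fall r = fun x => S (-1 * x + (r + 1)).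
Proof. by apply/funext => x; rewrite /fall mulN1r addrC. Qed.

Lemma smooth_fall r : smooth (fall r).
Proof. by rewrite fallE; apply: smooth_affine; exact: step_smooth. Qed.

Lemma is_derive_fall r x : is_derive x 1 (fall r) (- fall' r x).
Proof.
rewrite fallE (_ : - fall' r x = -1 * derive1 S (-1 * x + (r + 1))).
  exact: is_derive_affine S (-1) (r + 1) x (step_derivable _).
by rewrite /fall' !mulN1r [in RHS]addrC.
Qed.

Lemma smooth_cutoff h r : smooth (cutoff h r).
Proof. by apply: smoothM; [exact: smooth_rise|exact: smooth_fall]. Qed.

Lemma rise'_ge0 h x : 0 < h -> 0 <= rise' h x.
Proof.
move=> h0; apply: mulr_ge0; first by rewrite invr_ge0 ltW.
by case: HS => _ _ _ _ [_ /(_ (h^-1 * x)) /andP[]].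
Qed.

Lemma rise'_le h x : 0 < h -> rise' h x <= C / h.
Proof.
move=> h0; rewrite /rise' mulrC; apply: ler_wpM2r; first by rewrite invr_ge0 ltW.
by case: HS => _ _ _ _ [_ /(_ (h^-1 * x)) /andP[]].
Qed.

Lemma rise'_supp h x : 0 < h -> rise' h x != 0 -> 0 < x < h.
Proof.
move=> h0; apply: contraR; rewrite negb_and -!leNgt => /orP[x0|xh].
  rewrite /rise' (step0 _ _).2 ?mulr0//.
  by apply: (@le_trans _ _ 0); rewrite ?invr_ge0// mulr_ge0_le0// invr_ge0 ltW.
by rewrite /rise' (step1 _ _).2 ?mulr0// mulrC ler_pdivlMr// mul1r.
Qed.

Lemma fall'_ge0 r x : 0 <= fall' r x.
Proof. by case: HS => _ _ _ _ [_ /(_ (r + 1 - x)) /andP[]]. Qed.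

Lemma fall'_le r x : fall' r x <= C.
Proof. by case: HS => _ _ _ _ [_ /(_ (r + 1 - x)) /andP[]]. Qed.

Lemma fall'_supp r x : fall' r x != 0 -> r < x < r + 1.
Proof.
apply: contraR; rewrite negb_and -!leNgt => /orP[x0|xh].
  by rewrite /fall' (step1 _ _).2//; lra.
by rewrite /fall' (step0 _ _).2//; lra.
Qed.

Lemma rise0 h x : 0 < h -> x <= 0 -> rise h x = 0.
Proof.
move=> h0 x0; rewrite /rise (step0 _ _).1//.
by apply: (@le_trans _ _ 0); rewrite ?invr_ge0// mulr_ge0_le0// invr_ge0 ltW.
Qed.

Lemma rise1 h x : 0 < h -> h <= x -> rise h x = 1.
Proof. by move=> h0 xh; rewrite /rise (step1 _ _).1// mulrC ler_pdivlMr// mul1r. Qed.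

Lemma fall1 r x : x <= r -> fall r x = 1.
Proof. by move=> xr; rewrite /fall (step1 _ _).1//; lra. Qed.

(** Product rule; because h <= r, each slope lives where the other factor is 1. *)
Lemma derive1_cutoff h r x : 0 < h -> h <= r ->
  derive1 (cutoff h r) x = rise' h x - fall' r x.
Proof.
move=> h0 hr.
have -> : derive1 (cutoff h r) x = rise' h x * fall r x - rise h x * fall' r x.
  rewrite derive1E; apply: derive_val.
  refine (is_derive_eq (is_deriveM (is_derive_rise h x) (is_derive_fall r x)) _).
  by rewrite /GRing.scale/=; ring.
congr (_ - _).
  have [->|/(rise'_supp _ _ h0)/andP[_ xh]] := eqVneq (rise' h x) 0.
    by rewrite mul0r.
  by rewrite fall1 ?mulr1// ltW// (lt_le_trans xh).
have [->|/fall'_supp/andP[rx _]] := eqVneq (fall' r x) 0.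
  by rewrite mulr0.
by rewrite rise1 ?mul1r// ltW// (le_lt_trans hr).
Qed.

(** The slopes have disjoint supports, in (0, h) and (r, r + 1). Hence integrability against their
    difference, which is what a test function provides, passes to each of them. *)
Lemma rise'_fall' h r x : 0 < h -> h <= r ->
  rise' h x <= `|rise' h x - fall' r x| /\ fall' r x <= `|rise' h x - fall' r x|.
Proof.
move=> h0 hr; have A0 := rise'_ge0 h x h0; have B0 := fall'_ge0 r x.
have [E|/(rise'_supp _ _ h0)/andP[_ xh]] := eqVneq (rise' h x) 0.
  by rewrite E sub0r normrN ger0_norm// lexx.
have [E|/fall'_supp/andP[rx _]] := eqVneq (fall' r x) 0.
  by rewrite E subr0 ger0_norm// lexx.
by exfalso; have := lt_le_trans rx (ltW (lt_le_trans xh hr)); rewrite ltxx.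
Qed.

Lemma cutoff01 h r x : 0 <= cutoff h r x <= 1.
Proof.
have /andP[a0 a1] := step01 (h^-1 * x); have /andP[b0 b1] := step01 (r + 1 - x).
by rewrite mulr_ge0//= mulr_ile1.
Qed.

Lemma cutoff_supp h r x : 0 < h -> cutoff h r x != 0 -> h / 4 <= x <= r + 3 / 4.
Proof.
move=> h0; rewrite mulf_eq0 negb_or => /andP[h1 h2]; apply/andP; split.
  rewrite leNgt; apply: contra h1 => h1; apply/eqP; rewrite /rise (step0 _ _).1//.
  by rewrite ler_pdivrMl// ltW.
rewrite leNgt; apply: contra h2 => h2; apply/eqP; rewrite /fall (step0 _ _).1//.
by lra.
Qed.

Lemma integral_rise' h : 0 < h ->
  mu.-integrable setT (EFin \o rise' h) /\ \int[mu]_x rise' h x = 1.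
Proof.
move=> h0; rewrite -derive1_rise.
have [|i1 ->] := integral_derive1 _ 0 h h0 (smooth_rise h).
  move=> x; rewrite derive1_rise; apply: contraNeq => /(rise'_supp _ _ h0)/andP[x0 xh].
  by rewrite !ltW.
by split=> //; rewrite rise1// rise0// subr0.
Qed.

Lemma integral_fall' r :
  mu.-integrable setT (EFin \o fall' r) /\ \int[mu]_x fall' r x = 1.
Proof.
have E : fall' r = fun x => -1 * derive1 (fall r) x.
  by rewrite (derive1_ext _ _ (is_derive_fall r)); apply/funext => x /=; rewrite mulN1r opprK.
have [|||i1 I1] := integral_derive1 (fall r) r (r + 1); first by rewrite ltrDl.
- exact: smooth_fall.
- move=> x; rewrite (derive1_ext _ _ (is_derive_fall r)) => H.
  apply/eqP; rewrite oppr_eq0; apply: contraNT H => /fall'_supp/andP[rx xr].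
  by rewrite !ltW.
split; first by rewrite E; exact: (integrableZl measurableT (-1) i1).
rewrite E RintegralZl// I1 (fall1 _ _ (lexx r)) /fall subrr (step0 0 _).1 ?invr_ge0//.
by rewrite sub0r mulN1r opprK.
Qed.

Definition hseq (j : nat) : R := j.+1%:R^-1.
Definition rseq (j : nat) : R := j.+1%:R.

Lemma hseq_gt0 j : 0 < hseq j. Proof. by rewrite invr_gt0. Qed.
Lemma hseq_le1 j : hseq j <= 1. Proof. by rewrite invf_le1// ler1n. Qed.
Lemma hseq_le_rseq j : hseq j <= rseq j.
Proof. by rewrite (le_trans (hseq_le1 j))// ler1n. Qed.

Lemma near_hseq_lt x : 0 < x -> \forall j \near \oo, hseq j < x.
Proof. by move=> x0; near=> j; near: j; exact: near_infty_natSinv_lt (PosNum x0).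
Unshelve. all: by end_near. Qed.

Lemma near_rseq_gt x : \forall j \near \oo, x < rseq j.
Proof.
near=> j; apply: (@lt_le_trans _ _ j%:R); last by rewrite ler_nat.
by near: j; exact: nbhs_infty_gtr.
Unshelve. all: by end_near. Qed.

Lemma cvg_cutoff x : 0 < x -> cutoff (hseq j) (rseq j) x @[j --> \oo] --> (1 : R).
Proof.
move=> x0; apply: cvg_near_cst; near=> j; rewrite /cutoff rise1 ?hseq_gt0 ?fall1 ?mulr1//.
  by apply/ltW; near: j; exact: near_rseq_gt.
by apply/ltW; near: j; exact: near_hseq_lt.
Unshelve. all: by end_near. Qed.

(** Every point eventually leaves the support (0, h_j), although the slopes keep integral 1. *)
Lemma cvg_rise'0 x : rise' (hseq j) x @[j --> \oo] --> (0 : R).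
Proof.
have [x0|x0] := leP x 0.
  apply: cvg_near_cst; near=> j; apply/eqP; apply: contraT.
  by move=> /(rise'_supp _ _ (hseq_gt0 j)); rewrite ltNge x0.
apply: cvg_near_cst; near=> j; apply/eqP; apply: contraT.
move=> /(rise'_supp _ _ (hseq_gt0 j))/andP[_ xj].
suff /(lt_trans xj) : hseq j < x by rewrite ltxx.
by near: j; exact: near_hseq_lt.
Unshelve. all: by end_near. Qed.

End cutoffs.

(* [a], [b], [c], [t], [t'] stand for the values of the two pieces of the slope of
   the spatial cutoff, of the cutoff, of the time cutoff and of its derivative. *)
Lemma entropy_excess_pointwise {R : realType} (k x y t t' a b c : R) : 1 <= k -> 0 <= y ->
  0 <= t <= 1 -> 0 <= a -> 0 <= b -> 0 <= c <= 1 ->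
  (b != 0 -> 0 <= x <= 2) -> (c != 0 -> x <= 1) ->
  (`|y - k| + y - k) * (t' * c)
    + (Num.sg (y - k) + 1) * (flux x y - flux x k) * (t * (a - b))
    - (Num.sg (y - k) + 1) * flux_x x k * (t * c) <=
  2 * (Num.max (y - k) 0 * `|t'|) + 2 * (((k < y)%R)%:R * y ^+ 2 * (t * b)) -
  Num.max (y ^+ 2 - (2 * k) ^+ 2) 0 * (t * a).
Proof.
move=> k1 y0 /andP[t0 _] a0 b0 /andP[c0 c1] bx cx.
have Fx : 0 <= flux_x x k * (t * c).
  have [->|/cx x1] := eqVneq c 0; first by rewrite !mulr0.
  by rewrite mulr_ge0 ?mulr_ge0// /flux_x; lra.
have [yk|ky|->] := ltgtP y k.
- rewrite ltr0_norm ?subr_lt0// ltr0_sg ?subr_lt0// addNr !mul0r.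
  have M0 : y - k <= 0 by rewrite subr_le0 ltW.
  rewrite (max_r M0) max_r; last by rewrite subr_le0 ler_sqr ?nnegrE//; lra.
  have -> : - (y - k) + y - k = 0 by ring.
  by rewrite !mul0r !mulr0 add0r subr0.
- rewrite gtr0_norm ?subr_gt0// gtr0_sg ?subr_gt0//.
  have M0 : 0 <= y - k by rewrite subr_ge0 ltW.
  rewrite (max_l M0) mul1r.
  have H1 : (y - k + y - k) * (t' * c) <= 2 * ((y - k) * `|t'|).
    have -> : (y - k + y - k) * (t' * c) = 2 * ((y - k) * (t' * c)) by ring.
    rewrite ler_wpM2l// ler_wpM2l//.
    apply: (le_trans (ler_norm _)); rewrite normrM (ger0_norm c0).
    by rewrite -[leRHS]mulr1 ler_wpM2l.
  have fluxB : flux x y - flux x k = - ((y - k) * (y + k - (2 * x - x ^+ 2))).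
    by rewrite /flux; ring.
  (* Since 2x - x^2 <= 1 <= k, the right-hand side is at least 2 (y - k) y (t a), and 2 (y - k) y -
     (y^2 - 4 k^2) = (y - k)^2 + 3 k^2. *)
  have H2 : Num.max (y ^+ 2 - (2 * k) ^+ 2) 0 * (t * a) <=
      2 * ((y - k) * (y + k - (2 * x - x ^+ 2))) * (t * a).
    apply: ler_wpM2r; first exact: mulr_ge0.
    have := sqr_ge0 (x - 1); rewrite ge_max => sx.
    by apply/andP; split; nra.
  (* On the support of b one has 2x - x^2 >= 0, so the product is at most y^2 - k^2. *)
  have H3 : 2 * ((y - k) * (y + k - (2 * x - x ^+ 2))) * (t * b) <= 2 * (y ^+ 2 * (t * b)).
    have [->|/bx/andP[x0 x2]] := eqVneq b 0; first by rewrite !mulr0.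
    rewrite [leRHS]mulrA; apply: ler_wpM2r; first exact: mulr_ge0.
    rewrite ler_wpM2l//.
    have : 0 <= (y - k) * (x * (2 - x)).
      by rewrite mulr_ge0// mulr_ge0// subr_ge0.
    by nra.
  by rewrite fluxB; lra.
- rewrite subrr sgr0 normr0 !add0r subrr !(mulr0, mul0r) max_l// max_r; last by rewrite
  subr_le0 ler_sqr ?nnegrE//; lra.
  by lra.
Qed.

(** A crude domination by integrable functions, needed so that the integrals of the entropy argument
    can be added. Below level k the integrand vanishes; above it, 1 <= k <= y turns every constant
    into a multiple of y or y^2. *)
Lemma entropy_integrand_bound {R : realType} (K k x y t t' a b c : R) : 1 <= k -> 0 <= y ->
  0 <= t <= 1 -> `|t'| <= K -> 0 <= a -> 0 <= b -> 0 <= c <= 1 ->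
  (a != 0 -> 0 <= x <= 2) -> (b != 0 -> 0 <= x <= 2) -> (c != 0 -> 0 <= x <= 2) ->
  `|(`|y - k| + y - k) * (t' * c)
    + (Num.sg (y - k) + 1) * (flux x y - flux x k) * (t * (a - b))
    - (Num.sg (y - k) + 1) * flux_x x k * (t * c)| <=
  (2 * K + 4) * y + 4 * (y ^+ 2 * (t * a)) + 4 * (y ^+ 2 * (t * b)).
Proof.
move=> k1 y0 /andP[t0 t1] t'K a0 b0 /andP[c0 c1] ax bx cx.
have K0 : 0 <= K by exact: le_trans t'K.
have ta : 0 <= t * a by exact: mulr_ge0.
have tb : 0 <= t * b by exact: mulr_ge0.
have y2 := sqr_ge0 y.
have rhs0 : 0 <= (2 * K + 4) * y + 4 * (y ^+ 2 * (t * a)) + 4 * (y ^+ 2 * (t * b)).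
  by rewrite !addr_ge0// mulr_ge0// ?addr_ge0 ?mulr_ge0.
have [yk|ky] := ltP y k.
  rewrite (@ltr0_norm _ (y - k)) ?subr_lt0// ltr0_sg ?subr_lt0// addNr !mul0r.
  have -> : - (y - k) + y - k = 0 by ring.
  by rewrite mul0r addr0 subr0 normr0.
have [x02|x02] := boolP (0 <= x <= 2); last first.
  have -> : a = 0 by apply/eqP; apply: contraNT x02.
  have -> : b = 0 by apply/eqP; apply: contraNT x02.
  have -> : c = 0 by apply/eqP; apply: contraNT x02.
  rewrite !(mulr0, subr0, addr0) normr0 mulr_ge0// addr_ge0// mulr_ge0//.
have p2 : `|Num.sg (y - k) + 1| <= 2.
  apply: (le_trans (ler_normD _ _)); rewrite normr1 normr_sg.
  by case: (_ == _) => /=; lra.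
have M0 : 0 <= y - k by rewrite subr_ge0.
have H1 : `|(`|y - k| + y - k) * (t' * c)| <= 2 * y * K.
  rewrite normrM (ger0_norm M0); apply: ler_pM => //.
    by rewrite ger0_norm; lra.
  by rewrite normrM (ger0_norm c0) -[leRHS]mulr1 ler_pM.
have H2 : `|(Num.sg (y - k) + 1) * (flux x y - flux x k) * (t * (a - b))|
    <= 4 * (y ^+ 2 * (t * a)) + 4 * (y ^+ 2 * (t * b)).
  have -> : 4 * (y ^+ 2 * (t * a)) + 4 * (y ^+ 2 * (t * b)) = 2 * (2 * y ^+ 2) * (t * (a + b)).
    by ring.
  rewrite !normrM; apply: ler_pM; rewrite ?mulr_ge0//.
    apply: ler_pM => //.
    have -> : flux x y - flux x k = (y - k) * (2 * x - x ^+ 2 - y - k) by rewrite /flux; ring.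
    rewrite normrM (ger0_norm M0).
    have -> : 2 * y ^+ 2 = y * (2 * y) by ring.
    apply: ler_pM => //; first by lra.
    by rewrite ler_norml; nra.
  rewrite (ger0_norm t0) ler_wpM2l//; apply: (le_trans (ler_normB _ _)).
  by rewrite !ger0_norm.
have H3 : `|(Num.sg (y - k) + 1) * flux_x x k * (t * c)| <= 4 * y.
  have -> : 4 * y = 2 * (2 * y) * (1 * 1) by ring.
  rewrite !normrM (ger0_norm t0) (ger0_norm c0).
  apply: ler_pM; rewrite ?mulr_ge0//; last exact: ler_pM.
  apply: ler_pM => //.
  have k0 : 0 <= k by lra.
  rewrite (ger0_norm k0); apply: ler_pM => //.
  by rewrite ler_norml; lra.
apply: (le_trans (ler_normB _ _)).
apply: (le_trans (lerD (ler_normD _ _) (lexx _))).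
by lra.
Qed.

(** The square has slope at most 2c up to the point where the truncation freezes it. This is what
    lets an L^1 trace control truncated squares. *)
Lemma truncated_sqr_lipschitz {R : realType} (c x y : R) : 0 <= c ->
  `|Num.min (x ^+ 2) (c ^+ 2) - Num.min (y ^+ 2) (c ^+ 2)| <= 2 * c * `|x - y|.
Proof.
move=> c0.
wlog xy : x y / y ^+ 2 <= x ^+ 2.
  move=> H; have [yx|/ltW xy] := leP (y ^+ 2) (x ^+ 2); first exact: H.
  by rewrite distrC (distrC x); exact: H.
have yx : `|y| <= `|x| by rewrite -ler_sqr ?nnegrE// !real_normK ?num_real.
have xx : `|x| - `|y| <= `|x - y|.
  by apply: le_trans (ler_norm _) _; exact: ler_dist_dist.
rewrite -(real_normK (num_real x)) -(real_normK (num_real y)).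
have := normr_ge0 x; have := normr_ge0 y.
move: `|x| `|y| yx xx => X Y YX XY Y0 X0.
have [cX|Xc] := leP c X.
  have cX2 : c ^+ 2 <= X ^+ 2 by rewrite ler_sqr ?nnegrE.
  rewrite (min_r cX2).
  have [cY|/ltW Yc] := leP c Y.
    have cY2 : c ^+ 2 <= Y ^+ 2 by rewrite ler_sqr ?nnegrE.
    by rewrite (min_r cY2) subrr normr0 !mulr_ge0.
  have cY2 : Y ^+ 2 <= c ^+ 2 by rewrite ler_sqr ?nnegrE.
  rewrite (min_l cY2) ger0_norm ?subr_ge0//.
  by nra.
have cX2 : X ^+ 2 <= c ^+ 2 by rewrite ler_sqr ?nnegrE// ltW.
have cY2 : Y ^+ 2 <= c ^+ 2 by rewrite ler_sqr ?nnegrE//; lra.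
rewrite (min_l cX2) (min_l cY2) ger0_norm ?subr_ge0 ?ler_sqr ?nnegrE//.
by nra.
Qed.

(** * The flux through x = 0 for a fixed time cutoff *)

Section flux_through_origin.
Context {R : realType}.
Local Notation mu := (@lebesgue_measure R).
Local Notation mu2 := (mu \x mu)%E.
Local Notation L1 u := (mu2.-integrable setT (EFin \o u)).
Variables (S : R -> R) (C : R).
Hypothesis HS : step_function S C.
Variables (f : R * R -> R) (th : R -> R) (K : R).
Hypothesis f_int : L1 f.
Hypothesis f_ge0 : forall z : R * R, 0 <= f z.
Hypothesis f_supp : forall z : R * R, z.2 <= 0 -> f z = 0.
Hypothesis th_smooth : smooth th.
Hypothesis th01 : forall t, 0 <= th t <= 1.
Hypothesis th'K : forall t, `|derive1 th t| <= K.
Hypothesis th_int : mu.-integrable setT (EFin \o th).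
Hypothesis th'_int : mu.-integrable setT (EFin \o derive1 th).
Hypothesis th'_int0 : \int[mu]_t derive1 th t = 0.
Hypothesis weak : forall ch c d, smooth ch -> 0 < c ->
  (forall x, ch x != 0 -> c <= x <= d) ->
  (\int[mu2]_z (f z * (derive1 th z.1 * ch z.2)
    + flux z.2 (f z) * (th z.1 * derive1 ch z.2))%:E = 0)%E.
Hypothesis entropy : forall k ch c d, smooth ch -> 0 < c ->
  (forall x, ch x != 0 -> c <= x <= d) -> (forall x, 0 <= ch x) ->
  0 <= \int[mu2]_z (`|f z - k| * (derive1 th z.1 * ch z.2)
        + Num.sg (f z - k) * (flux z.2 (f z) - flux z.2 k)
          * (th z.1 * derive1 ch z.2)
        - Num.sg (f z - k) * flux_x z.2 k * (th z.1 * ch z.2)).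
Local Notation A := (rise' S).
Local Notation B := (fall' S).
Local Notation chi := (cutoff S).

Let mf : measurable_fun setT f.
Proof. by apply/measurable_EFinP; exact: measurable_int f_int. Qed.

Let m1 (u : R -> R) : measurable_fun setT u ->
  measurable_fun setT (fun z : R * R => u z.1).
Proof. by move=> mu_; exact: (measurableT_comp mu_ (@measurable_fst _ _ _ _)). Qed.

Let m2 (u : R -> R) : measurable_fun setT u ->
  measurable_fun setT (fun z : R * R => u z.2).
Proof. by move=> mu_; exact: (measurableT_comp mu_ (@measurable_snd _ _ _ _)). Qed.

Let mth : measurable_fun setT (fun z : R * R => th z.1).
Proof. by apply: m1; exact: smooth_measurable. Qed.

Let mth' : measurable_fun setT (fun z : R * R => derive1 th z.1).
Proof. by apply: m1; apply: smooth_measurable; exact: smooth_derive1. Qed.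

Let mA h : measurable_fun setT (fun z : R * R => A h z.2).
Proof.
apply: m2; rewrite -(derive1_rise _ _ HS).
by apply: smooth_measurable; apply: smooth_derive1; exact: smooth_rise HS _.
Qed.

Let mB r : measurable_fun setT (fun z : R * R => B r z.2).
Proof.
apply: m2; have -> : B r = \- derive1 (fall S r).
  by rewrite (derive1_ext _ _ (is_derive_fall _ _ HS r)); apply/funext => x /=; rewrite opprK.
apply: measurable_funN.
by apply: smooth_measurable; apply: smooth_derive1; exact: smooth_fall HS _.
Qed.

Let mchi h r : measurable_fun setT (fun z : R * R => chi h r z.2).
Proof. by apply: m2; apply: smooth_measurable; exact: smooth_cutoff HS _ _. Qed.

Let mx : measurable_fun setT (fun z : R * R => z.2).
Proof. exact: measurable_snd. Qed.

Let mflux (u : R * R -> R) : measurable_fun setT u ->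
  measurable_fun setT (fun z : R * R => flux z.2 (u z)).
Proof.
move=> mu_; apply: measurable_funB; last exact: measurable_funX.
apply: measurable_funM => //; apply: measurable_funB; last exact: measurable_funX.
by apply: measurable_funM => //; exact: measurable_cst.
Qed.

Lemma integrable_bounded_mul (w : R * R -> R) (M : R) :
  measurable_fun setT w -> (forall z, `|w z| <= M) -> L1 (fun z => f z * w z).
Proof.
move=> mw wM; have iMf : L1 (fun z => M * f z) by exact: (integrableZl measurableT M f_int).
apply: (integrable_le iMf); first exact: measurable_funM.
by move=> z; rewrite normrM (ger0_norm (f_ge0 z)) mulrC ler_wpM2r.
Qed.

Let K0 : 0 <= K.
Proof. exact: le_trans (th'K 0). Qed.

Let thchi_le h r z : `|derive1 th z.1 * chi h r z.2| <= K.
Proof.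
have /andP[a b] := cutoff01 _ _ HS h r z.2.
by rewrite normrM (ger0_norm a) -[leRHS]mulr1 ler_pM.
Qed.

(** A vanishing integral is finite, so the weak integrand is integrable. Its time part is integrable
    because f is, hence so is the flux against [A h - B r], and the disjoint supports of the slopes
    separate the two contributions. *)
Lemma weak_split h r : 0 < h -> h <= r ->
  [/\ L1 (fun z => flux z.2 (f z) * (th z.1 * A h z.2)),
      L1 (fun z => flux z.2 (f z) * (th z.1 * B r z.2)) &
      \int[mu2]_z (f z * (derive1 th z.1 * chi h r z.2)) +
      \int[mu2]_z (flux z.2 (f z) * (th z.1 * A h z.2)) -
      \int[mu2]_z (flux z.2 (f z) * (th z.1 * B r z.2)) = 0].
Proof.
move=> h0 hr.
pose W1 z := f z * (derive1 th z.1 * chi h r z.2).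
pose WA z := flux z.2 (f z) * (th z.1 * A h z.2).
pose WB z := flux z.2 (f z) * (th z.1 * B r z.2).
have i1 : L1 W1.
  apply: (@integrable_bounded_mul (fun z => derive1 th z.1 * chi h r z.2) K) => //.
  exact: measurable_funM.
have mWA : measurable_fun setT WA.
  by apply: measurable_funM; [exact: mflux|exact: measurable_funM].
have mWB : measurable_fun setT WB.
  by apply: measurable_funM; [exact: mflux|exact: measurable_funM].
have mW1 : measurable_fun setT W1 by apply/measurable_EFinP; exact: measurable_int i1.
have EW : (\int[mu2]_z (W1 z + (WA z - WB z))%:E = 0)%E.
  rewrite -(weak (chi h r) (h / 4) (r + 3 / 4)).
  - apply: eq_integral => z _; congr (_%:E).
    by rewrite (derive1_cutoff _ _ HS)// /W1 /WA /WB -mulrBr -mulrBr.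
  - exact: smooth_cutoff HS _ _.
  - by rewrite divr_gt0.
  - by move=> x; exact: (cutoff_supp _ _ HS).
have iW : L1 (fun z => W1 z + (WA z - WB z)).
  apply: fin_num_integrable; last by rewrite EW.
  by apply: measurable_funD => //; exact: measurable_funB.
have iAB : L1 (fun z => WA z - WB z).
  have := integrableB measurableT iW i1; congr (mu2.-integrable _ _).
  by apply/funext => z /=; congr (_%:E); rewrite addrC addrA addNr add0r.
have bnd (u : R -> R) : measurable_fun setT (fun z : R * R => u z.2) ->
    (forall x, 0 <= u x) -> (forall x, u x <= `|A h x - B r x|) ->
    L1 (fun z => flux z.2 (f z) * (th z.1 * u z.2)).
  move=> mu_ u0 uAB; have iN : L1 (fun z => `|WA z - WB z|) by exact: (integrable_abse iAB).
  apply: (integrable_le iN).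
    by apply: measurable_funM; [exact: mflux|exact: measurable_funM].
  move=> z; rewrite /WA /WB -mulrBr -mulrBr !normrM ler_wpM2l// ler_wpM2l//.
  by rewrite (ger0_norm (u0 _)).
have iA : L1 WA.
  apply: bnd => // x; first exact: (rise'_ge0 _ _ HS).
  exact: (rise'_fall' _ _ HS _ _ _ h0 hr).1.
have iB : L1 WB.
  apply: bnd => // x; first exact: (fall'_ge0 _ _ HS).
  exact: (rise'_fall' _ _ HS _ _ _ h0 hr).2.
split=> //; rewrite -addrA -RintegralB// -RintegralD//.
by rewrite /Rintegral EW.
Qed.


Let mdrift (u : R -> R) : measurable_fun setT (fun z : R * R => u z.2) ->
  measurable_fun setT (fun z : R * R => f z * ((2 * z.2 - z.2 ^+ 2) * (th z.1 * u z.2))).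
Proof.
move=> mu_; apply: measurable_funM => //; apply: measurable_funM; last exact: measurable_funM.
apply: measurable_funB; last exact: measurable_funX.
by apply: measurable_funM => //; exact: measurable_cst.
Qed.

(** The explicit constant matters: for a slope supported in [0, h] and bounded by C / h it equals (2
    + h) C, which is bounded as h -> 0. The pointwise estimate serves dominated convergence. *)
Lemma drift_integrable (u : R -> R) (M M' : R) :
  0 <= M -> measurable_fun setT (fun z : R * R => u z.2) ->
  (forall x, 0 <= u x <= M') -> (forall x, u x != 0 -> 0 <= x <= M) ->
  L1 (fun z => f z * ((2 * z.2 - z.2 ^+ 2) * (th z.1 * u z.2))) /\
  forall z, `|f z * ((2 * z.2 - z.2 ^+ 2) * (th z.1 * u z.2))| <=
    (2 * M + M ^+ 2) * M' * f z.
Proof.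
move=> M0 mu_ u0 uM.
have bnd (z : R * R) : `|(2 * z.2 - z.2 ^+ 2) * (th z.1 * u z.2)| <= (2 * M + M ^+ 2) * M'.
  have /andP[t0 t1] := th01 z.1; have /andP[v0 v1] := u0 z.2.
  have M'0 : 0 <= M' by exact: le_trans v1.
  have [E|/uM/andP[x0 xM]] := eqVneq (u z.2) 0.
    by rewrite E !mulr0 normr0 mulr_ge0// addr_ge0 ?mulr_ge0 ?exprn_ge0.
  rewrite normrM ler_pM//.
    by rewrite ler_norml; nra.
  by rewrite ger0_norm ?mulr_ge0// -[leRHS]mul1r ler_pM.
split.
  apply: (integrable_bounded_mul (fun z => (2 * z.2 - z.2 ^+ 2) * (th z.1 * u z.2)) _ _ bnd).
  apply: measurable_funM; last exact: measurable_funM.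
  apply: measurable_funB; last exact: measurable_funX.
  by apply: measurable_funM => //; exact: measurable_cst.
by move=> z; rewrite normrM (ger0_norm (f_ge0 z)) mulrC ler_wpM2r.
Qed.

(** Square integrability is gained from the flux: up to sign the two differ by the drift, which is
    linear in f with bounded coefficients on the support of u. *)
Lemma sqr_integrable (u : R -> R) (M M' : R) :
  0 <= M -> measurable_fun setT (fun z : R * R => u z.2) ->
  (forall x, 0 <= u x <= M') -> (forall x, u x != 0 -> 0 <= x <= M) ->
  L1 (fun z => flux z.2 (f z) * (th z.1 * u z.2)) ->
  L1 (fun z => f z ^+ 2 * (th z.1 * u z.2)) /\
  \int[mu2]_z (f z ^+ 2 * (th z.1 * u z.2)) =
  \int[mu2]_z (f z * ((2 * z.2 - z.2 ^+ 2) * (th z.1 * u z.2))) -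
  \int[mu2]_z (flux z.2 (f z) * (th z.1 * u z.2)).
Proof.
move=> M0 mu_ u0 uM ifl; have [idr _] := drift_integrable u M M' M0 mu_ u0 uM.
have E : (fun z => f z ^+ 2 * (th z.1 * u z.2)) =
  (fun z => f z * ((2 * z.2 - z.2 ^+ 2) * (th z.1 * u z.2)) - flux z.2 (f z) * (th z.1 *
    u z.2)).
  by apply/funext => z; rewrite /flux; ring.
split; last by rewrite E RintegralB.
by rewrite E; exact: (integrableB measurableT idr ifl).
Qed.

Let A0 h x : 0 < h -> 0 <= A h x <= C / h.
Proof. by move=> h0; rewrite (rise'_ge0 _ _ HS)// (rise'_le _ _ HS). Qed.

Let Asupp h x : 0 < h -> A h x != 0 -> 0 <= x <= h.
Proof. by move=> h0 /(rise'_supp _ _ HS _ _ h0)/andP[x0 xh]; rewrite !ltW. Qed.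

Let B0 r x : 0 <= B r x <= C.
Proof. by rewrite (fall'_ge0 _ _ HS) (fall'_le _ _ HS). Qed.

Let Bsupp r x : 0 < r -> B r x != 0 -> 0 <= x <= r + 1.
Proof. by move=> r0 /(fall'_supp _ _ HS)/andP[x0 xh]; rewrite !ltW// (lt_trans r0). Qed.

Lemma sqr_rise'_integrable h : 0 < h -> L1 (fun z => f z ^+ 2 * (th z.1 * A h z.2)).
Proof.
move=> h0; have [iA _ _] := weak_split h h h0 (lexx h).
exact: (sqr_integrable _ h (C / h) (ltW h0) (mA h) (fun x => A0 h x h0) (fun x => Asupp h
  x h0) iA).1.
Qed.

Lemma sqr_fall'_integrable r : 0 < r -> L1 (fun z => f z ^+ 2 * (th z.1 * B r z.2)).
Proof.
move=> r0; have [_ iB _] := weak_split r r r0 (lexx r).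
exact: (sqr_integrable _ (r + 1) C (addr_ge0 (ltW r0) ler01) (mB r) (B0 r) (fun x =>
  Bsupp r x r0) iB).1.
Qed.

Hypothesis far : \int[mu2]_z (flux z.2 (f z) * (th z.1 * B (rseq j) z.2))
  @[j --> \oo] --> (0 : R).

(** Solving the weak identity for n^2 near x = 0 leaves three terms: the drift, which vanishes by
    dominated convergence since x <= h cancels the 1 / h of the slope; the time term, in which the
    cutoff tends to 1; and the far flux, which tends to 0. *)
Lemma cvg_sqr_rise' :
  \int[mu2]_z (f z ^+ 2 * (th z.1 * A (hseq j) z.2)) @[j --> \oo] -->
  \int[mu2]_z (f z * derive1 th z.1).
Proof.
have dom_C j (z : R * R) : `|f z * ((2 * z.2 - z.2 ^+ 2) * (th z.1 * A (hseq j) z.2))| <=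
  3 * C * f z.
  have h0 := @hseq_gt0 R j; have h1 : hseq j <= (1 : R) := @hseq_le1 R j.
  have [_ bnd] := drift_integrable _ (hseq j) (C / hseq j) (ltW h0) (mA _) (fun x => A0 _
    x h0) (fun x => Asupp _ x h0).
  apply: (le_trans (bnd z)); rewrite ler_wpM2r//.
  have -> : (2 * hseq j + hseq j ^+ 2) * (C / hseq j) = (2 + hseq j) * C by field; exact:
    lt0r_neq0.
  by rewrite ler_wpM2r ?(step_slope_ge0 _ _ HS)//; lra.
have E j : \int[mu2]_z (f z ^+ 2 * (th z.1 * A (hseq j) z.2)) =
    \int[mu2]_z (f z * ((2 * z.2 - z.2 ^+ 2) * (th z.1 * A (hseq j) z.2)))
    + (\int[mu2]_z (f z * (derive1 th z.1 * chi (hseq j) (rseq j) z.2))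
    - \int[mu2]_z (flux z.2 (f z) * (th z.1 * B (rseq j) z.2))).
  have h0 := @hseq_gt0 R j.
  have [iA iB /eqP] := weak_split _ _ h0 (@hseq_le_rseq R j).
  rewrite -addrA addrCA addr_eq0 => /eqP e.
  rewrite (sqr_integrable _ _ _ (ltW h0) (mA _) (fun x => A0 _ x h0) (fun x => Asupp _ x
    h0) iA).2.
  by rewrite e opprK.
under eq_fun do rewrite E.
rewrite (_ : \int[mu2]_z (f z * derive1 th z.1) =
  0 + (\int[mu2]_z (f z * derive1 th z.1) - 0)); last by rewrite add0r subr0.
apply: cvgD; last (apply: cvgB; last exact: far).
  have -> : (0 : R) = \int[mu2]_z (cst 0 z) by rewrite /Rintegral integral0.
  have ig : L1 (fun z => 3 * C * f z) by exact: (integrableZl measurableT (3 * C) f_int).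
  apply: (dominated_Rintegral _ _ _ ig).
  - by move=> j; exact: mdrift.
  - exact: measurable_cst.
  - move=> z; under eq_fun do rewrite 2!mulrA.
    rewrite /= -(mulr0 (f z * (2 * z.2 - z.2 ^+ 2) * th z.1)).
    apply: cvgM; first exact: cvg_cst.
    exact: cvg_rise'0 HS _.
  - exact: dom_C.
have ig : L1 (fun z => K * f z) by exact: (integrableZl measurableT K f_int).
apply: (dominated_Rintegral _ _ _ ig).
- move=> j; have H : measurable_fun setT (fun z : R * R => derive1 th z.1 * chi (hseq j)
  (rseq j) z.2).
    exact: measurable_funM.
  exact: (measurable_funM mf H).
- exact: (measurable_funM mf mth').
(* For x <= 0 the cutoffs stay 0 instead of tending to 1, but f vanishes there. *)
- move=> z; have [x0|x0] := leP z.2 0.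
    by under eq_fun do rewrite f_supp// mul0r; rewrite f_supp// mul0r; exact: cvg_cst.
  under eq_fun do rewrite mulrA.
  have := cvgM (cvg_cst (f z * derive1 th z.1)) (@cvg_cutoff _ _ _ HS z.2 x0).
  by rewrite mulr1; exact.
- by move=> j z; rewrite normrM (ger0_norm (f_ge0 z)) mulrC ler_wpM2r.
Qed.


(** Up to a factor 2, a bound for the terms in the balance of (n - k)_+ other than the outflow at x
    = 0: the time slope and the descent of the spatial cutoff. The descent starts at 1/4 so as to
    end at x = 1. *)
Definition entropy_excess k : R :=
  \int[mu2]_z (Num.max (f z - k) 0 * `|derive1 th z.1|) +
  \int[mu2]_z (((k < f z)%R)%:R * f z ^+ 2 * (th z.1 * B 4^-1 z.2)).


Lemma excess_time_integrable k : 0 <= k ->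
  L1 (fun z => Num.max (f z - k) 0 * `|derive1 th z.1|).
Proof.
move=> k0; have iKf : L1 (fun z => K * f z) by exact: (integrableZl measurableT K f_int).
have mm : measurable_fun setT (fun z : R * R => Num.max (f z - k) 0 * `|derive1 th z.1|).
  apply: measurable_funM.
    apply: measurable_maxr; last exact: measurable_cst.
    by apply: measurable_funB => //; exact: measurable_cst.
  exact: (measurableT_comp (@normr_measurable R setT) mth').
apply: (integrable_le iKf mm) => z.
rewrite normrM normr_id mulrC ler_pM// ger0_norm ?le_max ?lexx ?orbT//.
by rewrite ge_max f_ge0 andbT; lra.
Qed.

Lemma excess_fall_integrable k :
  L1 (fun z => ((k < f z)%R)%:R * f z ^+ 2 * (th z.1 * B 4^-1 z.2)).
Proof.
have q0 : 0 < 4^-1 :> R by rewrite invr_gt0.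
have i2 := sqr_fall'_integrable 4^-1 q0.
have mm : measurable_fun setT (fun z : R * R => ((k < f z)%R)%:R * f z ^+ 2 * (th z.1 * B
  4^-1 z.2)).
  apply: measurable_funM; last exact: measurable_funM.
  apply: measurable_funM; last exact: measurable_funX.
  have -> : (fun z => ((k < f z)%R)%:R) = (fun z : R * R => if k < f z then (1 : R) else 0).
    by apply/funext => z; case: ifP.
  apply: measurable_fun_ifT; [|exact: measurable_cst..].
  by apply: measurable_fun_ltr => //; exact: measurable_cst.
apply: (integrable_le i2 mm) => z.
have b0 : 0 <= th z.1 * B 4^-1 z.2.
  by have /andP[? _] := th01 z.1; have /andP[? _] := B0 4^-1 z.2; rewrite mulr_ge0.
rewrite normrM (ger0_norm b0) ler_wpM2r// normrM (ger0_norm (sqr_ge0 _)).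
by rewrite -[leRHS]mul1r ler_wpM2r ?sqr_ge0//; case: (k < f z); rewrite ?normr1 ?normr0.
Qed.

Lemma sqr_excess_integrable k h : 0 < h ->
  L1 (fun z => Num.max (f z ^+ 2 - (2 * k) ^+ 2) 0 * (th z.1 * A h z.2)).
Proof.
move=> h0; have i2 := sqr_rise'_integrable h h0.
have mm : measurable_fun setT (fun z : R * R => Num.max (f z ^+ 2 - (2 * k) ^+ 2) 0 * (th
  z.1 * A h z.2)).
  apply: measurable_funM; last exact: measurable_funM.
  apply: measurable_maxr; last exact: measurable_cst.
  by apply: measurable_funB; [exact: measurable_funX|exact: measurable_cst].
apply: (integrable_le i2 mm) => z.
have b0 : 0 <= th z.1 * A h z.2.
  by have /andP[? _] := th01 z.1; have /andP[? _] := A0 h z.2 h0; rewrite mulr_ge0.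
rewrite normrM (ger0_norm b0) ler_wpM2r// ger0_norm ?le_max ?lexx ?orbT//.
by rewrite ge_max sqr_ge0 andbT lerBlDr lerDl sqr_ge0.
Qed.

(* Adding the weak formulation, minus its trivial analogue for the constant [k],
   to the entropy inequality for [k] yields the inequality for the entropy
   [(n - k)_+]. For [x <= 1] its source term has a sign, so the resulting bound
   does not depend on [h]: no mass of [n ^ 2] concentrates at [x = 0]. *)
Lemma entropy_rise' k h : 1 <= k -> 0 < h -> h <= 4^-1 ->
  \int[mu2]_z (Num.max (f z ^+ 2 - (2 * k) ^+ 2) 0 * (th z.1 * A h z.2)) <=
  2 * entropy_excess k.
Proof.
move=> k1 h0 h4; have k0 : 0 <= k by lra.
have q0 : 0 < 4^-1 :> R by rewrite invr_gt0.
pose ch := chi h 4^-1; pose ab x := A h x - B 4^-1 x.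
have sch : smooth ch by exact: smooth_cutoff HS _ _.
have chS x : ch x != 0 -> h / 4 <= x <= 4^-1 + 3 / 4.
  exact: (cutoff_supp _ _ HS).
have ch' x : derive1 ch x = ab x by rewrite (derive1_cutoff _ _ HS).
have c0 : 0 < h / 4 by rewrite divr_gt0.
(* [U] is the entropy integrand plus [W - V]. As [p] is 2 above level k and 0 below, [U] is, off the
   set f = k, twice the integrand for the entropy (n - k)_+. *)
pose p z := Num.sg (f z - k) + 1.
pose U z := (`|f z - k| + f z - k) * (derive1 th z.1 * ch z.2)
    + p z * (flux z.2 (f z) - flux z.2 k) * (th z.1 * ab z.2)
    - p z * flux_x z.2 k * (th z.1 * ch z.2).
pose W z := f z * (derive1 th z.1 * ch z.2) + flux z.2 (f z) * (th z.1 * ab z.2).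
pose V z := k * (derive1 th z.1 * ch z.2) +
    th z.1 * (flux_x z.2 k * ch z.2 + flux z.2 k * ab z.2).
pose D z := 2 * (Num.max (f z - k) 0 * `|derive1 th z.1|)
  + 2 * (((k < f z)%R)%:R * f z ^+ 2 * (th z.1 * B 4^-1 z.2)).
pose E z := Num.max (f z ^+ 2 - (2 * k) ^+ 2) 0 * (th z.1 * A h z.2).
have UDE z : U z <= D z - E z.
  apply: entropy_excess_pointwise => //.
  - exact: (rise'_ge0 _ _ HS).
  - exact: (fall'_ge0 _ _ HS).
  - exact: (cutoff01 _ _ HS).
  - by move=> /(fall'_supp _ _ HS); lra.
  - by move=> /chS; lra.
have mab : measurable_fun setT (fun z : R * R => ab z.2) by exact: measurable_funB.
have mch : measurable_fun setT (fun z : R * R => ch z.2) by exact: mchi.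
have EW : (\int[mu2]_z (W z)%:E = 0)%E.
  rewrite -(weak ch (h / 4) (4^-1 + 3 / 4))//.
  by apply: eq_integral => z _; rewrite ch'.
have iW : L1 W /\ \int[mu2]_z W z = 0.
  split; last by rewrite /Rintegral EW.
  apply: fin_num_integrable; last by rewrite EW.
  apply: measurable_funD.
    by apply: measurable_funM => //; exact: measurable_funM.
  by apply: measurable_funM; [exact: mflux|exact: measurable_funM].
(* A constant solves the equation up to the source [flux_x], so [V] is a sum of two tensor products,
   each with an exact derivative as a factor: k times the time slope in t, and the slope of [psi] in
   x. *)
have iV : L1 V /\ \int[mu2]_z V z = 0.
  have ich : mu.-integrable setT (EFin \o ch).
    apply: (continuous_supp_integrable _ (h / 4) (4^-1 + 3 / 4) (smooth_continuous sch)).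
    by move=> x; apply: contraNeq => /chS.
  pose psi x := flux x k * ch x.
  pose P : {poly R} := k *: (2 *: 'X - 'X ^+ 2) - (k ^+ 2)%:P.
  have fluxE : (fun x => flux x k) = horner P.
    by apply/funext => x; rewrite /flux /P !hornerE; ring.
  have dflux (x : R) : is_derive x 1 (fun x => flux x k) (flux_x x k).
    rewrite fluxE; apply: is_derive_eq; rewrite /P /flux_x !poly.derivE !hornerE.
    by ring.
  have dpsi (x : R) : is_derive x 1 psi (flux_x x k * ch x + flux x k * ab x).
    have dch : is_derive x 1 ch (ab x).
      by rewrite -ch' derive1E; apply: derivableP; exact: smooth_derivable.
    refine (is_derive_eq (is_deriveM (dflux x) dch) _).
    by rewrite /GRing.scale/=; ring.
  have spsi : smooth psi by apply: smoothM => //; rewrite fluxE; exact: smooth_horner.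
  have ch0 x : ~~ (0 <= x <= 2) -> ch x = 0.
    by apply: contraNeq => /chS; lra.
  have psi0 x : ~~ (0 <= x <= 2) -> derive1 psi x = 0.
    move=> x02; rewrite (derive1_ext _ _ dpsi) ch0// /ab.
    have -> : A h x = 0.
      by apply/eqP; apply: contraNT x02 => /(rise'_supp _ _ HS _ _ h0); lra.
    have -> : B 4^-1 x = 0.
      by apply/eqP; apply: contraNT x02 => /(fall'_supp _ _ HS); lra.
    by rewrite subr0 !mulr0 addr0.
  have [ipsi Ipsi'] := integral_derive1 psi 0 2 (ltr0Sn _ _) spsi psi0.
  have Ipsi : \int[mu]_x derive1 psi x = 0.
    have ch00 : ch 0 = 0 by apply/eqP; apply: contraT => /chS; lra.
    have ch2 : ch 2 = 0 by apply/eqP; apply: contraT => /chS; lra.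
    by rewrite Ipsi' /psi ch00 ch2 !mulr0 subr0.
  have i1 := integrable_tensor _ _ th'_int ich.
  have i2 := integrable_tensor _ _ th_int ipsi.
  have i1' : L1 (fun z => k * (derive1 th z.1 * ch z.2)) by exact: (integrableZl
    measurableT k i1).
  have VE : V = fun z => k * (derive1 th z.1 * ch z.2) + th z.1 * derive1 psi z.2.
    by apply/funext => z; rewrite (derive1_ext _ _ dpsi).
  rewrite VE; split; first exact: (integrableD measurableT i1' i2).
  rewrite RintegralD// RintegralZl//.
  by rewrite (Rintegral_tensor _ _ th'_int ich) (Rintegral_tensor _ _ th_int ipsi)
    th'_int0 Ipsi !(mulr0, mul0r) addr0.
(* Integrability of [U] must come first: only then can [W - V], of integral 0, be subtracted to
   reach the integrand of the entropy inequality. *)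
have iU : L1 U.
  have iA := sqr_rise'_integrable h h0; have iB := sqr_fall'_integrable _ q0.
  have iG1 : L1 (fun z => (2 * K + 4) * f z) by exact: (integrableZl measurableT (2 * K +
    4) f_int).
  have iG2 : L1 (fun z => 4 * (f z ^+ 2 * (th z.1 * A h z.2))).
    exact: (integrableZl measurableT 4 iA).
  have iG3 : L1 (fun z => 4 * (f z ^+ 2 * (th z.1 * B 4^-1 z.2))).
    exact: (integrableZl measurableT 4 iB).
  have iG12 : L1 (fun z => (2 * K + 4) * f z + 4 * (f z ^+ 2 * (th z.1 * A h z.2))).
    exact: (integrableD measurableT iG1 iG2).
  have iG : L1 (fun z => (2 * K + 4) * f z + 4 * (f z ^+ 2 * (th z.1 * A h z.2))
      + 4 * (f z ^+ 2 * (th z.1 * B 4^-1 z.2))).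
    exact: (integrableD measurableT iG12 iG3).
  have mU : measurable_fun setT U.
    have mfk : measurable_fun setT (fun z : R * R => f z - k).
      by apply: measurable_funB => //; exact: measurable_cst.
    have mp : measurable_fun setT p.
      by apply: measurable_funD; [exact: (measurableT_comp measurable_sgr mfk)|exact:
        measurable_cst].
    apply: measurable_funB; last first.
      apply: measurable_funM; last exact: measurable_funM.
      apply: measurable_funM => //; apply: measurable_funM; last exact: measurable_cst.
      apply: measurable_funB; first exact: measurable_cst.
      by apply: measurable_funM => //; exact: measurable_cst.
    apply: measurable_funD.
      apply: measurable_funM; last exact: measurable_funM.
      apply: measurable_funB; last exact: measurable_cst.
      by apply: measurable_funD => //; exact: (measurableT_comp (@normr_measurable R setT) mfk).
    apply: measurable_funM; last exact: measurable_funM.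
    apply: measurable_funM => //; apply: measurable_funB; first exact: mflux.
    by apply: mflux; exact: measurable_cst.
  apply: (integrable_le iG mU) => z; apply: entropy_integrand_bound => //.
  - exact: (rise'_ge0 _ _ HS).
  - exact: (fall'_ge0 _ _ HS).
  - exact: (cutoff01 _ _ HS).
  - by move=> /(rise'_supp _ _ HS _ _ h0); lra.
  - by move=> /(fall'_supp _ _ HS); lra.
  - by move=> /chS; lra.
have iE : L1 E := sqr_excess_integrable k h h0.
have i1 := excess_time_integrable k k0.
have i2 := excess_fall_integrable k.
have i1' : L1 (fun z => 2 * (Num.max (f z - k) 0 * `|derive1 th z.1|)).
  exact: (integrableZl measurableT 2 i1).
have i2' : L1 (fun z => 2 * (((k < f z)%R)%:R * f z ^+ 2 * (th z.1 * B 4^-1 z.2))).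
  exact: (integrableZl measurableT 2 i2).
have iD : L1 D by exact: (integrableD measurableT i1' i2').
have ED : \int[mu2]_z D z = 2 * entropy_excess k.
  by rewrite /D RintegralD// RintegralZl// RintegralZl// -mulrDr.
have IU : 0 <= \int[mu2]_z U z.
  have := entropy k ch _ _ sch c0 chS (fun x => (andP (cutoff01 _ _ HS h 4^-1 x)).1).
  have -> : \int[mu2]_z U z = \int[mu2]_z (U z - (W z - V z)).
    have iWV : L1 (fun z => W z - V z) by exact: (integrableB measurableT iW.1 iV.1).
    by rewrite (RintegralB measurableT iU iWV) (RintegralB measurableT iW.1 iV.1) iW.2
      iV.2 !subr0.
  congr (0 <= _); apply: eq_Rintegral => z _.
  by rewrite ch' /U /W /V /p; ring.
have UD : \int[mu2]_z U z <= \int[mu2]_z (D z - E z).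
  by apply: le_Rintegral => //; exact: (integrableB measurableT iD iE).
rewrite -/(E _) -ED -subr_ge0 -(RintegralB measurableT iD iE).
exact: le_trans UD.
Qed.

(** At each point both integrands vanish once j exceeds the value of f, and the dominating
    functions, [K * f] and the untruncated square on the descent, do not depend on j. *)
Lemma cvg_entropy_excess : entropy_excess j%:R @[j --> \oo] --> (0 : R).
Proof.
have I0 : \int[mu2]_z (cst (0 : R) z) = 0 by rewrite /Rintegral integral0.
rewrite -(addr0 0); apply: cvgD.
  have iKf : L1 (fun z => K * f z) by exact: (integrableZl measurableT K f_int).
  suff : \int[mu2]_z (Num.max (f z - j%:R) 0 * `|derive1 th z.1|) @[j --> \oo] -->
      \int[mu2]_z (cst (0 : R) z) by rewrite I0.
  apply: (dominated_Rintegral _ _ _ iKf).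
  - by move=> j; apply/measurable_EFinP; exact: (measurable_int mu2
    (excess_time_integrable j%:R (ler0n R j))).
  - exact: measurable_cst.
  - move=> z; apply: cvg_near_cst; near=> j.
    rewrite max_r ?mul0r// subr_le0; apply: ltW; near: j; exact: nbhs_infty_gtr.
  - move=> j z; rewrite normrM normr_id mulrC ler_pM// ger0_norm ?le_max ?lexx ?orbT//.
    by rewrite ge_max f_ge0 andbT gerBl ler0n.
have q0 : 0 < 4^-1 :> R by rewrite invr_gt0.
have i2 := sqr_fall'_integrable 4^-1 q0.
suff : \int[mu2]_z (((j%:R < f z)%R)%:R * f z ^+ 2 * (th z.1 * B 4^-1 z.2)) @[j --> \oo] -->
    \int[mu2]_z (cst (0 : R) z) by rewrite I0.
apply: (dominated_Rintegral _ _ _ i2).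
- by move=> j; apply/measurable_EFinP; exact: (measurable_int mu2 (excess_fall_integrable
  j%:R)).
- exact: measurable_cst.
- move=> z; apply: cvg_near_cst; near=> j.
  rewrite ltNge (_ : f z <= _) ?mul0r//; apply: ltW; near: j; exact: nbhs_infty_gtr.
- move=> j z.
  have b0 : 0 <= th z.1 * B 4^-1 z.2.
    by have /andP[? _] := th01 z.1; have /andP[? _] := B0 4^-1 z.2; rewrite mulr_ge0.
  rewrite normrM (ger0_norm b0) ler_wpM2r// normrM (ger0_norm (sqr_ge0 _)).
  by rewrite -[leRHS]mul1r ler_wpM2r ?sqr_ge0//; case: (_ < f z); rewrite ?normr1 ?normr0.
Unshelve. all: by end_near. Qed.


Variable g : R -> R.
Hypothesis mg : measurable_fun setT g.
Hypothesis trace : (\int[mu2]_z (th z.1 * A (hseq j) z.2 * `|f z - g z.1|)%:E)%E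
  @[j --> \oo] --> 0%E.

Let g1 : measurable_fun setT (fun z : R * R => g z.1). Proof. exact: m1. Qed.

Let mthA h : measurable_fun setT (fun z : R * R => th z.1 * A h z.2).
Proof. exact: measurable_funM. Qed.

Let thA0 h z : 0 < h -> 0 <= th z.1 * A h z.2.
Proof.
by move=> h0; have /andP[? _] := th01 z.1; have /andP[? _] := A0 h z.2 h0; rewrite mulr_ge0.
Qed.

Lemma truncated_sqr_integrable c h : 0 < h ->
  L1 (fun z => Num.min (f z ^+ 2) (c ^+ 2) * (th z.1 * A h z.2)).
Proof.
move=> h0; have i2 := sqr_rise'_integrable h h0.
have mm : measurable_fun setT (fun z : R * R => Num.min (f z ^+ 2) (c ^+ 2) * (th z.1 * A
  h z.2)).
  apply: measurable_funM; last exact: measurable_funM.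
  by apply: measurable_minr; [exact: measurable_funX|exact: measurable_cst].
apply: (integrable_le i2 mm) => z.
rewrite normrM (ger0_norm (thA0 h z h0)) ler_wpM2r ?thA0// ger0_norm.
  by rewrite ge_min lexx.
by rewrite le_min !sqr_ge0.
Qed.

Lemma truncated_trace_integrable c :
  mu.-integrable setT (EFin \o (fun t => Num.min (g t ^+ 2) (c ^+ 2) * th t)).
Proof.
have ic : mu.-integrable setT (EFin \o (fun t => c ^+ 2 * th t)).
  exact: (integrableZl measurableT (c ^+ 2) th_int).
have mm : measurable_fun setT (fun t : R => Num.min (g t ^+ 2) (c ^+ 2) * th t).
  apply: measurable_funM; last exact: smooth_measurable.
  by apply: measurable_minr; [exact: measurable_funX|exact: measurable_cst].
apply: (integrable_le ic mm) => t; have /andP[t0 _] := th01 t.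
rewrite normrM (ger0_norm t0) ler_wpM2r// ger0_norm; first by rewrite ge_min lexx orbT.
by rewrite le_min !sqr_ge0.
Qed.

(** Since [A h] has integral 1, the limit is also a plane integral against the same kernel. The
    difference is then at most 2c times the weighted L^1 distance between f and g, which the trace
    sends to 0. That distance stays in [\bar R], as its finiteness is not known beforehand. *)
Lemma cvg_truncated c : 0 <= c ->
  \int[mu2]_z (Num.min (f z ^+ 2) (c ^+ 2) * (th z.1 * A (hseq j) z.2)) @[j --> \oo] -->
  \int[mu]_t (Num.min (g t ^+ 2) (c ^+ 2) * th t).
Proof.
move=> c0; have ig := truncated_trace_integrable c.
have Eg j : \int[mu]_t (Num.min (g t ^+ 2) (c ^+ 2) * th t) =
    \int[mu2]_z (Num.min (g z.1 ^+ 2) (c ^+ 2) * th z.1 * A (hseq j) z.2).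
  have [iA IA] := integral_rise' _ _ HS (hseq j) (@hseq_gt0 R j).
  by rewrite (Rintegral_tensor _ _ ig iA) IA mulr1.
pose w j (z : R * R) := Num.min (f z ^+ 2) (c ^+ 2) * (th z.1 * A (hseq j) z.2)
  - Num.min (g z.1 ^+ 2) (c ^+ 2) * th z.1 * A (hseq j) z.2.
have iw j : L1 (w j) /\ \int[mu2]_z (Num.min (f z ^+ 2) (c ^+ 2) * (th z.1 * A (hseq j) z.2))
    - \int[mu]_t (Num.min (g t ^+ 2) (c ^+ 2) * th t) = \int[mu2]_z w j z.
  have i1 := truncated_sqr_integrable c (hseq j) (@hseq_gt0 R j).
  have [iA _] := integral_rise' _ _ HS (hseq j) (@hseq_gt0 R j).
  have i2 := integrable_tensor _ _ ig iA.
  by rewrite (Eg j) -(RintegralB measurableT i1 i2); split=> //; exact: (integrableB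
    measurableT i1 i2).
have bnd j : (`|\int[mu2]_z w j z|%:E <=
    (2 * c)%:E * \int[mu2]_z (th z.1 * A (hseq j) z.2 * `|f z - g z.1|)%:E)%E.
  have [iwj _] := iw j.
  have mw : measurable_fun setT (w j) by apply/measurable_EFinP; exact: (measurable_int
    mu2 iwj).
  have mD : measurable_fun setT (fun z : R * R => th z.1 * A (hseq j) z.2 * `|f z - g z.1|).
    apply: measurable_funM => //.
    have mfg : measurable_fun setT (fun z : R * R => f z - g z.1) by exact: measurable_funB.
    exact: (measurableT_comp (@normr_measurable R setT) mfg).
  rewrite -ge0_integralZl//; last 3 first.
  - exact/measurable_EFinP.
  - by move=> z _; rewrite lee_fin mulr_ge0// thA0 ?hseq_gt0.
  - by rewrite lee_fin mulr_ge0.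
  rewrite -abse_EFin -integral_Rintegral//.
  apply: (le_trans (le_abse_integral mu2 measurableT _)); first exact/measurable_EFinP.
  apply: ge0_le_integral => //.
  - by apply: measurableT_comp => //; exact/measurable_EFinP.
  - by apply/measurable_EFinP; apply: measurable_funM => //; exact: measurable_cst.
  move=> z _; rewrite -EFinM lee_fin /w -(mulrA _ (th z.1)) -mulrBl normrM.
  have a0 := thA0 (hseq j) z (@hseq_gt0 R j).
  rewrite (ger0_norm a0) [leRHS]mulrCA mulrC ler_wpM2l//.
  exact: truncated_sqr_lipschitz.
have cw : (`|\int[mu2]_z w j z|%:E @[j --> \oo] --> 0)%E.
  apply: (@squeeze_cvge _ _ _ _ (cst 0%E) _ (fun j =>
    (2 * c)%:E * \int[mu2]_z (th z.1 * A (hseq j) z.2 * `|f z - g z.1|)%:E)%E).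
  - by apply: nearW => j; rewrite bnd andbT lee_fin.
  - exact: cvg_cst.
  - by rewrite -(mule0 (2 * c)%:E); apply: cvgeZl trace.
apply/subr_cvg0; under eq_fun do rewrite (iw _).2.
by apply/norm_cvg0P; exact: (fine_cvg cw).
Qed.

(** A squeeze for the truncated outflow [G k]: truncation only decreases n^2, which gives
    [G k <= L], while the part cut off is at most [2 * entropy_excess], uniformly in h. The
    left-hand side lives in [\bar R], so integrability of the weighted g^2 is part of the
    conclusion. *)
Lemma flux_trace_identity :
  (\int[mu]_t (th t * g t ^+ 2)%:E = (\int[mu2]_z (f z * derive1 th z.1))%:E)%E.
Proof.
set L := \int[mu2]_z (f z * derive1 th z.1).
(* The level 2 (k + 1) matches [entropy_rise'] for the constant k + 1, which is at least 1 even when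
   k = 0. *)
pose G k := \int[mu]_t (Num.min (g t ^+ 2) ((2 * k.+1%:R) ^+ 2) * th t).
have c0 k : 0 <= 2 * k.+1%:R :> R by [].
have GL k : G k <= L.
  apply: (ler_cvg_to (cvg_truncated _ (c0 k)) cvg_sqr_rise').
  apply: nearW => j; apply: le_Rintegral => //.
  - exact: truncated_sqr_integrable (@hseq_gt0 R j).
  - exact: sqr_rise'_integrable (@hseq_gt0 R j).
  by move=> z _; rewrite ler_wpM2r ?thA0 ?hseq_gt0// ge_min lexx.
have LG k : L - 2 * entropy_excess k.+1%:R <= G k.
  have cvgQ : \int[mu2]_z (f z ^+ 2 * (th z.1 * A (hseq j) z.2)) - 2 * entropy_excess k.+1%:R
      @[j --> \oo] --> L - 2 * entropy_excess k.+1%:R.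
    by apply: cvgB; [exact: cvg_sqr_rise'|exact: cvg_cst].
  apply: (ler_cvg_to cvgQ (cvg_truncated _ (c0 k))).
  have q0 : 0 < 4^-1 :> R by rewrite invr_gt0.
  near=> j; have h0 := @hseq_gt0 R j.
  have h4 : hseq j <= 4^-1 :> R by apply: ltW; near: j; exact: near_hseq_lt.
  rewrite lerBlDr; have k1 : 1 <= k.+1%:R :> R by rewrite ler1n.
  apply: (le_trans _ (lerD (lexx _) (entropy_rise' _ _ k1 h0 h4))).
  have i1 := truncated_sqr_integrable (2 * k.+1%:R) _ h0.
  have i2 := sqr_excess_integrable k.+1%:R _ h0.
  rewrite -(RintegralD measurableT i1 i2); apply: le_Rintegral => //.
  - exact: sqr_rise'_integrable.
  - exact: (integrableD measurableT i1 i2).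
  move=> z _; rewrite -mulrDl ler_wpM2r ?thA0//.
  have [a|/ltW a] := leP (f z ^+ 2) ((2 * k.+1%:R) ^+ 2).
    by rewrite max_r ?addr0// subr_le0.
  by rewrite max_l ?subr_ge0// addrCA subrr addr0.
have cG : G k @[k --> \oo] --> L.
  apply: (@squeeze_cvgr _ _ _ _ (fun k => L - 2 * entropy_excess k.+1%:R) (cst L)).
  - by apply: nearW => k; rewrite LG GL.
  - have cx : entropy_excess k.+1%:R @[k --> \oo] --> (0 : R).
      have := cvg_entropy_excess.
      by rewrite -(cvg_shiftS (fun j => entropy_excess j%:R)).
    have := cvgB (cvg_cst L) (cvgM (cvg_cst (2 : R)) cx).
    by rewrite mulr0 subr0; exact.
  - exact: cvg_cst.
have cE : (fun k => \int[mu]_t (Num.min (g t ^+ 2) ((2 * k.+1%:R) ^+ 2) * th t)%:E)%E @ \oo -->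
    (\int[mu]_t (th t * g t ^+ 2)%:E)%E.
  have mm k : measurable_fun setT
      (fun t => (Num.min (g t ^+ 2) ((2 * k.+1%:R) ^+ 2) * th t)%:E).
    exact: (measurable_int mu (truncated_trace_integrable (2 * k.+1%:R))).
  rewrite (_ : \int[mu]_t (th t * g t ^+ 2)%:E =
    \int[mu]_t limn (fun k => (Num.min (g t ^+ 2) ((2 * k.+1%:R) ^+ 2) * th t)%:E))%E.
    apply: cvg_monotone_convergence => //.
    - move=> k t _; have /andP[t0 _] := th01 t.
      by rewrite lee_fin mulr_ge0// le_min !sqr_ge0.
    - move=> t _ a b ab; have /andP[t0 _] := th01 t.
      rewrite lee_fin ler_wpM2r// le_min ge_min lexx/= ge_min; apply/orP; right.
      by rewrite ler_sqr ?nnegrE// ler_wpM2l// ler_nat.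
  apply: eq_integral => t _; apply/esym/cvg_lim => //.
  apply: cvg_near_cst; near=> k; congr (_%:E); rewrite mulrC min_l//.
  rewrite -(real_normK (num_real (g t))) ler_sqr ?nnegrE//.
  apply: (@le_trans _ _ k%:R).
    by apply: ltW; near: k; exact: nbhs_infty_gtr.
  by rewrite -natrM ler_nat; lia.
have cE' : (fun k => \int[mu]_t (Num.min (g t ^+ 2) ((2 * k.+1%:R) ^+ 2) * th t)%:E)%E @
  \oo --> L%:E.
  under eq_fun do rewrite (integral_Rintegral (truncated_trace_integrable _)).
  by apply: cvg_EFin; [exact: nearW|exact: cG].
exact: (cvg_unique _ cE cE').
Unshelve. all: by end_near. Qed.

End flux_through_origin.

Lemma derive1_supp {R : realType} (u : R -> R) (a b : R) :
  (forall x, u x != 0 -> a <= x <= b) ->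
  forall x, derive1 u x != 0 -> a <= x <= b.
Proof.
move=> su x; apply: contraR => xab.
have H : is_derive x 1 (cst (0:R)) 0 by exact: is_derive_cst.
rewrite derive1E; apply/eqP; apply: derive_val; apply: near_eq_is_derive H.
move: xab; rewrite negb_and -!ltNge => /orP[xa|bx].
  near=> y; apply/esym/eqP; apply: contraT => /su/andP[ay _].
  suff : y < a by rewrite ltNge ay.
  by near: y; exact: lt_nbhsl.
near=> y; apply/esym/eqP; apply: contraT => /su/andP[_ yb].
suff : b < y by rewrite ltNge yb.
by near: y; exact: lt_nbhsr.
Unshelve. all: by end_near. Qed.

(** * From the class of n to a density defined on the whole plane *)

Section restriction.
Context {R : realType}.
Local Notation mu := (@lebesgue_measure R).
Local Notation mu2 := (mu \x mu)%E.
Local Notation L1 u := (mu2.-integrable setT (EFin \o u)).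
Variables (T : R) (n : R -> R -> R).
Local Notation D := (`]0, T[ `*` `]0, +oo[ : set (R * R)).

(* [n] is only given up to a null set of [(0, T) x (0, oo)]; [density] is an
   everywhere nonnegative representative, extended by 0. *)
Definition density : R * R -> R :=
  (fun z => Num.max (n z.1 z.2) 0) \_ D.

Local Notation f := density.

Hypothesis n_int : mu2.-integrable (`[0, T] `*` `[0, +oo[) (fun z => (n z.1 z.2)%:E).
Hypothesis n_ge0 : nonnegative n.

Let mD : measurable D.
Proof. by apply: measurableX; exact: measurable_itv. Qed.

Lemma density_ge0 z : 0 <= f z.
Proof. by rewrite /f patchE; case: ifP => // _; rewrite le_max lexx orbT. Qed.

Lemma density_out z : ~ D z -> f z = 0.
Proof. by move=> Dz; rewrite /f patchE memNset. Qed.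

Lemma density_supp z : z.2 <= 0 -> f z = 0.
Proof.
move=> z0; apply: density_out => -[_ /=].
by rewrite in_itv/= andbT ltNge z0.
Qed.

Let nD : mu2.-integrable D (EFin \o (fun z => n z.1 z.2)).
Proof.
apply: integrableS n_int => //.
  by apply: measurableX; exact: measurable_itv.
move=> z [] /=; rewrite !in_itv/= => /andP[a b] /andP[c _].
by rewrite !ltW.
Qed.

Let mn : measurable_fun D (fun z => n z.1 z.2).
Proof. by apply/measurable_EFinP; exact: (measurable_int mu2 nD). Qed.

Lemma density_integrable : L1 f.
Proof.
rewrite /f -restrict_EFin; apply/integrable_restrict => //; rewrite setTI.
apply: le_integrable nD => //.
  by apply/measurable_EFinP; apply: measurable_maxr => //; exact: measurable_cst.
move=> z _ /=; rewrite lee_fin ger0_norm ?le_max ?lexx ?orbT//.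
by rewrite ge_max ler_norm normr_ge0.
Qed.

Let mf : measurable_fun setT f.
Proof. by apply/measurable_EFinP; exact: (measurable_int mu2 density_integrable). Qed.

Lemma density_ae : {ae mu2, forall z, D z -> f z = n z.1 z.2}.
Proof.
apply: (@filterS _ _ (ae_filter_ringOfSetsType mu2)) n_ge0 => z h Dz; rewrite /f patchE
  mem_set//.
case: Dz; rewrite /= !in_itv/= => /andP[a _] /andP[b _].
by rewrite max_l// h.
Qed.

(** A general integrand [Phi] covers the weak form, the entropy form and the trace averages at once.
    Measurability is asked on E only, because n is known to be measurable only inside the domain. *)
Lemma integral_density (E : set (R * R)) (Phi : R * R -> R -> R) :
  E `<=` D -> measurable E ->
  (forall u, measurable_fun E u -> measurable_fun E (fun z => Phi z (u z))) ->
  (\int[mu2]_(z in E) (Phi z (n z.1 z.2))%:E = \int[mu2]_(z in E) (Phi z (f z))%:E)%E.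
Proof.
move=> ED mE mPhi; apply: ae_eq_integral => //.
- by apply/measurable_EFinP; apply: mPhi; exact: measurable_funS mn.
- by apply/measurable_EFinP; apply: mPhi; exact: measurable_funTS.
- by apply: (@filterS _ _ (ae_filter_ringOfSetsType mu2)) density_ae => z h Ez; rewrite
  h//; exact: ED.
Qed.

Lemma integral_vanish_out (u : R * R -> \bar R) : (forall z, ~ D z -> u z = 0%E) ->
  (\int[mu2]_(z in D) u z = \int[mu2]_z u z)%E.
Proof.
move=> u0; rewrite integral_mkcond; apply: eq_integral => z _.
rewrite patchE; case: ifPn => //; rewrite notin_setE => /u0 ->//.
Qed.

Section weak_and_entropy.
Variables (th ch : R -> R) (a b c d : R).
Hypothesis th_smooth : smooth th.
Hypothesis ch_smooth : smooth ch.
Hypothesis a0 : 0 < a.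
Hypothesis bT : b < T.
Hypothesis c0 : 0 < c.
Hypothesis thS : forall t, th t != 0 -> a <= t <= b.
Hypothesis chS : forall x, ch x != 0 -> c <= x <= d.

Local Notation phi := (fun z : R * R => th z.1 * ch z.2).

Let test : test_function T phi.
Proof. exact: (@test_function_tensor _ T a b c d th ch). Qed.

Let Dt z : 'D_(1, 0) phi z = derive1 th z.1 * ch z.2.
Proof.
apply: (@derive_val _ _ _ _ _ _ _ (derive_tensor_t th ch z _)).
exact: smooth_derivable.
Qed.

Let Dx z : 'D_(0, 1) phi z = th z.1 * derive1 ch z.2.
Proof.
apply: (@derive_val _ _ _ _ _ _ _ (derive_tensor_x th ch z _)).
exact: smooth_derivable.
Qed.

Let mth : measurable_fun setT (fun z : R * R => th z.1).
Proof. exact: (measurableT_comp (smooth_measurable _ th_smooth) (@measurable_fst _ _ _ _)). Qed.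

Let mth' : measurable_fun setT (fun z : R * R => derive1 th z.1).
Proof. exact: (measurableT_comp (smooth_measurable _ (smooth_derive1 _ th_smooth))
  (@measurable_fst _ _ _ _)). Qed.

Let mch : measurable_fun setT (fun z : R * R => ch z.2).
Proof. exact: (measurableT_comp (smooth_measurable _ ch_smooth) (@measurable_snd _ _ _ _)). Qed.

Let mch' : measurable_fun setT (fun z : R * R => derive1 ch z.2).
Proof. exact: (measurableT_comp (smooth_measurable _ (smooth_derive1 _ ch_smooth))
  (@measurable_snd _ _ _ _)). Qed.

Let mx : measurable_fun setT (fun z : R * R => z.2).
Proof. exact: measurable_snd. Qed.

Let mflux (u : R * R -> R) : measurable_fun D u ->
  measurable_fun D (fun z : R * R => flux z.2 (u z)).
Proof.
move=> mu_; apply: measurable_funB; last exact: measurable_funX.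
have mxD : measurable_fun D (fun z : R * R => z.2) by exact: measurable_funTS.
apply: measurable_funM => //; apply: measurable_funB; last exact: measurable_funX.
by apply: measurable_funM => //; exact: measurable_cst.
Qed.

Let mt1 : measurable_fun D (fun z : R * R => derive1 th z.1 * ch z.2).
Proof. by apply: measurable_funTS; exact: measurable_funM. Qed.

Let mt2 : measurable_fun D (fun z : R * R => th z.1 * derive1 ch z.2).
Proof. by apply: measurable_funTS; exact: measurable_funM. Qed.

Let mt3 : measurable_fun D (fun z : R * R => th z.1 * ch z.2).
Proof. by apply: measurable_funTS; exact: measurable_funM. Qed.

Lemma density_weak : weak_solution T n ->
  (\int[mu2]_z (f z * (derive1 th z.1 * ch z.2)
    + flux z.2 (f z) * (th z.1 * derive1 ch z.2))%:E = 0)%E.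
Proof.
move=> /(_ phi test) W; rewrite -integral_vanish_out; last first.
  by move=> z /density_out ->; rewrite /flux !(mul0r, mulr0, expr0n)/= subrr mul0r addr0.
rewrite -[RHS]W.
rewrite -(integral_density D (fun z y => y * (derive1 th z.1 * ch z.2)
    + flux z.2 y * (th z.1 * derive1 ch z.2)))//.
  by apply: eq_integral => z _; rewrite Dt Dx.
move=> u mu_; apply: measurable_funD; first exact: measurable_funM.
by apply: measurable_funM => //; exact: mflux.
Qed.

Lemma density_entropy k : (forall t, 0 <= th t) -> (forall x, 0 <= ch x) ->
  entropy_inequality T n ->
  0 <= \int[mu2]_z (`|f z - k| * (derive1 th z.1 * ch z.2)
        + Num.sg (f z - k) * (flux z.2 (f z) - flux z.2 k)
          * (th z.1 * derive1 ch z.2)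
        - Num.sg (f z - k) * flux_x z.2 k * (th z.1 * ch z.2)).
Proof.
move=> th0 ch0 /(_ k phi test) W; rewrite /Rintegral fine_ge0//.
(* Off the domain [f z = 0] does not make the integrand vanish, as |0 - k| may be positive. The
   supports of th and ch have to do it, one for each way of leaving the domain. *)
rewrite -integral_vanish_out; last first.
  move=> z Dz; have [t0|t0] := boolP (0 < z.1 < T).
    have x0 : z.2 <= 0.
      by rewrite leNgt; apply/negP => x0; apply: Dz; split; rewrite /= in_itv//= x0.
    have xcd : ~~ (c <= z.2 <= d).
      by apply/negP => /andP[cx _]; have := lt_le_trans c0 (le_trans cx x0); rewrite ltxx.
    have -> : ch z.2 = 0 by apply/eqP; apply: contraNT xcd => /chS.
    have -> : derive1 ch z.2 = 0.
      by apply/eqP; apply: contraNT xcd => /(derive1_supp _ _ _ chS).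
    by rewrite !mulr0 addr0 subr0.
  have tab : ~~ (a <= z.1 <= b).
    apply: contra t0 => /andP[az zb].
    by rewrite (lt_le_trans a0 az) (le_lt_trans zb bT).
  have -> : th z.1 = 0 by apply/eqP; apply: contraNT tab => /thS.
  have -> : derive1 th z.1 = 0.
    by apply/eqP; apply: contraNT tab => /(derive1_supp _ _ _ thS).
  by rewrite !mul0r !mulr0 addr0 subr0.
rewrite -(integral_density D (fun z y => `|y - k| * (derive1 th z.1 * ch z.2)
        + Num.sg (y - k) * (flux z.2 y - flux z.2 k)
          * (th z.1 * derive1 ch z.2)
        - Num.sg (y - k) * flux_x z.2 k * (th z.1 * ch z.2)))//.
  apply: (le_trans (W _)); first by move=> z; rewrite mulr_ge0.
  by rewrite le_eqVlt; apply/orP; left; apply/eqP; apply: eq_integral => z _; rewrite Dt Dx.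
move=> u mu_.
have mfk : measurable_fun D (fun z : R * R => u z - k).
  by apply: measurable_funB => //; exact: measurable_cst.
have msg := measurableT_comp measurable_sgr mfk.
apply: measurable_funB; last first.
  apply: measurable_funM => //; apply: measurable_funM; first exact: msg.
  apply: measurable_funM; last exact: measurable_cst.
  apply: measurable_funB; first exact: measurable_cst.
  by apply: measurable_funM; [exact: measurable_cst|exact: measurable_funTS].
apply: measurable_funD.
  apply: measurable_funM => //.
  exact: (measurableT_comp (@normr_measurable R setT) mfk).
apply: measurable_funM => //; apply: measurable_funM; first exact: msg.
apply: measurable_funB; first exact: mflux.
by apply: mflux; exact: measurable_cst.
Qed.

End weak_and_entropy.

End restriction.

(** * Slices and traces *)

Section slices.
Context {R : realType}.
Local Notation mu := (@lebesgue_measure R).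
Local Notation mu2 := (mu \x mu)%E.
Local Notation L1 u := (mu2.-integrable setT (EFin \o u)).

Lemma ae_forall_countable d (X : measurableType d) (m : {measure set X -> \bar R})
    (I : countType) (P : I -> X -> Prop) :
  (forall i, {ae m, forall x, P i x}) -> {ae m, forall x, forall i, P i x}.
Proof.
move=> H; pose Q k x := if unpickle k is Some i then P i x else True.
have : {ae m, forall x, forall k, Q k x}.
  by apply: ae_foralln => k; rewrite /Q; case: unpickle => [i|]; [exact: H|exact: aeW].
apply: (@filterS _ _ (ae_filter_ringOfSetsType m)).

by move=> x Qx i; have := Qx (pickle i); rewrite /Q pickleK.
Qed.

Lemma abse_fine_le (y : \bar R) : (`|fine y|%:E <= `|y|)%E.
Proof. by case: y => [r| |] /=; rewrite ?leey. Qed.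

(** Fubini with real-valued inner integrals. Non-integrable slices form a null set, so the value
    that [fine] gives to an infinite inner integral has no effect on the outer one. *)
Lemma integrable_slice_x (F : R * R -> R) : L1 F ->
  [/\ mu.-integrable setT (EFin \o (fun x => \int[mu]_t F (t, x))) ,
      \int[mu2]_z F z = \int[mu]_x \int[mu]_t F (t, x) &
      {ae mu, forall x, mu.-integrable setT (fun t => (F (t, x))%:E)}].
Proof.
move=> iF; have ae2 := ae_integrable2 iF.
have mF := measurable_int _ iF.
have mG : measurable_fun setT (fun x => (\int[mu]_t F (t, x))%:E).
  apply/measurable_EFinP; apply: (measurableT_comp (fine_measurable measurableT)).
  exact: measurable_fubini_G iF.
split=> //.
  apply/integrableP; split => //.
  apply: le_lt_trans ((integrable21ltyP mu mu mF).1 iF).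
  apply: ge0_le_integral => //.
  - exact: measurableT_comp.
  - have mAF : measurable_fun setT (fun z : R * R => `|(F z)%:E|%E).
      by apply: measurableT_comp => //; exact: mF.
    by apply: (measurable_fun_fubini_tonelli_G (m1 := mu) (abse \o (EFin \o F))) ; [exact
      mAF|move=> z; exact: abse_ge0].
  move=> x _; apply: (@le_trans _ _ `|\int[mu]_t (F (t, x))%:E|%E).
    exact: abse_fine_le.
  apply: le_abse_integral => //.
  by apply: (measurableT_comp mF); exact: pair2_measurable.
rewrite [in LHS]/Rintegral -(integral21_prod_meas1 iF) /Rintegral; congr fine.
apply: ae_eq_integral => //; first exact: measurable_fubini_G iF.
apply: filterS ae2 => x ix _; rewrite fineK//.
exact: (integrable_fin_num measurableT ix).
Qed.

Lemma integrable_slice_t (F : R * R -> R) : L1 F ->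
  [/\ mu.-integrable setT (EFin \o (fun t => \int[mu]_x F (t, x))) ,
      \int[mu2]_z F z = \int[mu]_t \int[mu]_x F (t, x) &
      {ae mu, forall t, mu.-integrable setT (fun x => (F (t, x))%:E)}].
Proof.
move=> iF; have ae1 := ae_integrable1 iF.
have iG := integrable_fubini_F iF.
have mG : measurable_fun setT (fun t => (\int[mu]_x F (t, x))%:E).
  apply/measurable_EFinP; apply: (measurableT_comp (fine_measurable measurableT)).
  exact: measurable_fubini_F iF.
split=> //.
  apply: le_integrable iG => // x _; rewrite /= /Rintegral /fubini_F /=.
  exact: abse_fine_le.
rewrite [in LHS]/Rintegral -(integral12_prod_meas1 iF) /Rintegral; congr fine.
apply: ae_eq_integral => //; first exact: measurable_fubini_F iF.
apply: filterS ae1 => x ix _; rewrite fineK//.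
exact: (integrable_fin_num measurableT ix).
Qed.

Lemma hseq_cvg0 : @hseq R j @[j --> \oo] --> (0 : R).
Proof. exact: cvg_harmonic. Qed.

(** The ratio 2 compares an interval of length at least h_j with the ball of radius h_j. One-sided
    intervals qualify, as left traces require, and so do intervals with rational endpoints. *)
Lemma nicely_shrinking_itv (x : R) (p q : nat -> R) :
  (forall j, [/\ x - hseq j <= p j, p j + hseq j <= q j & q j <= x + hseq j]) ->
  nicely_shrinking x (fun j => `]p j, q j[%classic).
Proof.
move=> pq; split; first by move=> j; exact: measurable_itv.
exists (2, fun j => PosNum (@hseq_gt0 R j)); split => //=.
- exact: hseq_cvg0.
- move=> j y /=; rewrite in_itv/= => /andP[py yq]; have [xp _ qx] := pq j.
  by rewrite /ball/= ltr_distlC; lra.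
- move=> j; have [_ pq' _] := pq j; have h0 := @hseq_gt0 R j.
  rewrite (lebesgue_measure_ball _ (ltW h0)) lebesgue_measure_itv/= lte_fin.
  rewrite ifT; last by lra.
  by rewrite -EFinD -EFinM lee_fin; lra.
Qed.

(** Lebesgue differentiation along rational intervals shrinking to t. Rational endpoints let a
    caller check the hypothesis on countably many intervals, so that exceptional null sets can be
    united. *)
Lemma ae_zero_of_rational_integrals (w : R -> R) (a b : R) :
  mu.-integrable setT (EFin \o w) ->
  (forall p q : rat, a < ratr p -> ratr q < b ->
     (\int[mu]_(t in `]ratr p, ratr q[) (w t)%:E = 0)%E) ->
  {ae mu, forall t, a < t < b -> w t = 0}.
Proof.
move=> iw w0.
(* One endpoint is taken in (x - h, x - h/2), the other in (x + h/2, x + h), so the length is at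
   least h. *)
have rat_ex (x : R) j : exists pq : rat * rat,
    [/\ x - hseq j <= ratr pq.1, ratr pq.1 + hseq j <= ratr pq.2 :> R & ratr pq.2 <= x +
      hseq j].
  have h0 := @hseq_gt0 R j.
  have /rat_in_itvoo[p /itvP hp] : x - hseq j < x - hseq j / 2 by lra.
  have /rat_in_itvoo[q /itvP hq] : x + hseq j / 2 < x + hseq j by lra.
  exists (p, q) => /=.
  have p1 : ratr p <= x - hseq j / 2 by rewrite ltW// hp.
  have q1 : x + hseq j / 2 <= ratr q by rewrite ltW// hq.
  split; [by rewrite ltW// hp| |by rewrite ltW// hq].
  by lra.
pose pq x j := sval (cid (rat_ex x j)).
have pqP x j := svalP (cid (rat_ex x j)).
pose E x j : set R := `]ratr (pq x j).1, ratr (pq x j).2[%classic.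
have hE x : nicely_shrinking x (E x) by apply: nicely_shrinking_itv => j; exact: pqP.
have lw : locally_integrable setT w by apply: open_integrable_locally => //; exact: openT.
have := lebesgue_differentiation lw.
apply: (@filterS _ _ (ae_filter_ringOfSetsType mu)).
move=> t tw /andP[at_ tb].
have H := nice_lebesgue_differentiation hE lw tw.
suff H0 : ((mu (E t j))^-1 * \int[mu]_(y in E t j) (w y)%:E)%E @[j --> \oo] --> 0%E.
  by have [] : (w t)%:E = 0%E by exact: (cvg_unique _ H H0).
apply: cvg_near_cst; near=> j; rewrite w0 ?mule0//.
  have [h _ _] := pqP t j; apply: lt_le_trans h; rewrite ltrBrDr addrC -ltrBrDr.
  by near: j; apply: near_hseq_lt; rewrite subr_gt0.
have [_ _ h] := pqP t j; apply: le_lt_trans h _; rewrite addrC -ltrBrDr.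
by near: j; apply: near_hseq_lt; rewrite subr_gt0.
Unshelve. all: by end_near. Qed.

End slices.

(** * Left traces and averages of slab masses *)

Section slice_traces.
Context {R : realType}.
Local Notation mu := (@lebesgue_measure R).
Local Notation mu2 := (mu \x mu)%E.
Local Notation L1 u := (mu2.-integrable setT (EFin \o u)).
Variables (T : R) (n : R -> R -> R).
Hypothesis n_int : mu2.-integrable (`[0, T] `*` `[0, +oo[) (fun z => (n z.1 z.2)%:E).
Hypothesis n_ge0 : nonnegative n.
Local Notation f := (density T n).

Let f_int : L1 f. Proof. exact: density_integrable. Qed.

Let mf : measurable_fun setT f.
Proof. by apply/measurable_EFinP; exact: (measurable_int mu2 f_int). Qed.

Lemma box_integral (g : R -> R) (a b c d : R) : measurable_fun `]0, T[ g ->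
  0 <= a -> b <= T -> 0 <= c ->
  (\int[mu2]_(z in `]a, b[ `*` `]c, d[) `|n z.1 z.2 - g z.1|%:E =
   \int[mu2]_z (\1_(`]a, b[) z.1 * \1_(`]c, d[) z.2 * `|f z - (g \_ `]0, T[) z.1|)%:E)%E.
Proof.
move=> mg a0 bT c0; pose B : set (R * R) := `]a, b[ `*` `]c, d[.
have mB : measurable B by apply: measurableX; exact: measurable_itv.
have mg' : measurable_fun setT (g \_ `]0, T[) by apply/(measurable_restrictT _ _).1.
have mg1 : measurable_fun setT (fun z : R * R => (g \_ `]0, T[) z.1).
  exact: (measurableT_comp mg' (@measurable_fst _ _ _ _)).
have BD : B `<=` `]0, T[ `*` `]0, +oo[.
  move=> z []; rewrite /= !in_itv/= => /andP[a1 b1] /andP[c1 _].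
  by rewrite (le_lt_trans a0 a1) (lt_le_trans b1 bT) (le_lt_trans c0 c1).
transitivity (\int[mu2]_(z in B) (`|n z.1 z.2 - (g \_ `]0, T[) z.1|)%:E)%E.
  apply: eq_integral => z; rewrite inE => /BD[z1 _].
  by rewrite [in RHS]patchE mem_set.
rewrite (integral_density T n n_int n_ge0 B (fun z y => `|y - (g \_ `]0, T[) z.1|))//;
  last first.
  move=> u mu_.
  have H : measurable_fun B (fun z : R * R => u z - (g \_ `]0, T[) z.1).
    by apply: measurable_funB => //; exact: measurable_funTS.
  exact: (measurableT_comp (@normr_measurable R setT) H).
rewrite integral_mkcond; apply: eq_integral => z _.
rewrite patchE !indicE.
have -> : (z \in B) = (z.1 \in `]a, b[%classic) && (z.2 \in `]c, d[%classic).
  by apply/idP/andP; rewrite !inE => -[].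
by case: (z.1 \in _); case: (z.2 \in _); rewrite /= ?(mul1r, mul0r).
Qed.

Definition slab_mass (a b x : R) : R := \int[mu]_t (\1_(`]a, b[) t * f (t, x)).

Let mab (a b : R) : measurable_fun setT (fun z : R * R => (\1_(`]a, b[) z.1 : R)).
Proof.
have H : measurable_fun setT (\1_(`]a, b[) : R -> R) by apply: measurable_indic; exact:
  measurable_itv.
exact: (measurableT_comp H (@measurable_fst _ _ _ _)).
Qed.

Let mcd (a b : R) : measurable_fun setT (fun z : R * R => (\1_(`]a, b[) z.2 : R)).
Proof.
have H : measurable_fun setT (\1_(`]a, b[) : R -> R) by apply: measurable_indic; exact:
  measurable_itv.
exact: (measurableT_comp H (@measurable_snd _ _ _ _)).
Qed.

Let indic01 (E : set R) t : 0 <= (\1_E t : R) <= 1.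
Proof. by rewrite indicE; case: (t \in E) => /=; rewrite lexx ler01. Qed.

Lemma slab_integrable (a b : R) : L1 (fun z => \1_(`]a, b[) z.1 * f z).
Proof.
have mm : measurable_fun setT (fun z : R * R => \1_(`]a, b[) z.1 * f z) by exact:
  measurable_funM.
apply: (integrable_le f_int mm) => z; have /andP[i0 i1] := indic01 `]a, b[ z.1.
rewrite normrM (ger0_norm i0) (ger0_norm (density_ge0 _ _ _)).
by rewrite -[leRHS]mul1r ler_wpM2r// density_ge0.
Qed.

Lemma slab_mass_integrable (a b : R) : mu.-integrable setT (EFin \o slab_mass a b).
Proof. by have [] := integrable_slice_x _ (slab_integrable a b). Qed.

(** Averages of the slab mass over (x - h, x) have two limits that must agree: the value at x, by
    Lebesgue differentiation along one-sided intervals, and the integral of s over (a, b), by the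
    trace condition. *)
Lemma slab_mass_trace (s : R -> R) (a b x : R) : 0 < a -> a < b -> b < T -> 0 < x ->
  left_trace T n x s -> lebesgue_pt (slab_mass a b) x ->
  mu.-integrable setT (EFin \o (fun t => \1_(`]a, b[) t * (s \_ `]0, T[) t)) /\
  slab_mass a b x = \int[mu]_t (\1_(`]a, b[) t * (s \_ `]0, T[) t).
Proof.
move=> a0 ab bT x0 [ms /(_ a b a0 ab bT) H] lx.
set s' := s \_ `]0, T[.
have ms' : measurable_fun setT s' by apply/(measurable_restrictT _ _).1.
have ms1 : measurable_fun setT (fun z : R * R => s' z.1).
  exact: (measurableT_comp ms' (@measurable_fst _ _ _ _)).
pose al t : R := \1_(`]a, b[) t.
pose be j y : R := \1_(`]x - hseq j, x[) y.
pose V j z := al z.1 * be j z.2 * `|f z - s' z.1|.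
have al01 t : 0 <= al t <= 1 := indic01 _ t.
have be01 j t : 0 <= be j t <= 1 := indic01 _ t.
have cV : ((hseq j)^-1%:E * \int[mu2]_z (V j z)%:E)%E @[j --> \oo] --> 0%E.
  have := (cvge_at_rightP _ _ _).1 H (@hseq R) (conj (@hseq_gt0 R) hseq_cvg0).
  apply: cvg_trans; apply: near_eq_cvg; near=> j.
  rewrite box_integral//; [exact: ltW|exact: ltW|].
  rewrite subr_ge0; apply: ltW; near: j; exact: near_hseq_lt.
have mV j : measurable_fun setT (V j).
  apply: measurable_funM; first by apply: measurable_funM; [exact: mab|exact: mcd].
  have mfs : measurable_fun setT (fun z : R * R => f z - s' z.1) by exact: measurable_funB.
  exact: (measurableT_comp (@normr_measurable R setT) mfs).
have V0 j z : 0 <= V j z.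
  by have /andP[? _] := al01 z.1; have /andP[? _] := be01 j z.2; rewrite !mulr_ge0.
(* A sequence tending to 0 in [\bar R] is eventually finite, and division by the positive h_j cannot
   hide an infinite integral. *)
have iV : \forall j \near \oo, L1 (V j).
  have := cvg_is_fine cV; apply: filterS => j fj.
  apply: fin_num_integrable; first exact (mV j).
  have I0 : (0 <= \int[mu2]_z (V j z)%:E)%E by apply: integral_ge0 => z _; rewrite lee_fin.
  rewrite ge0_fin_numE// ltey; apply/eqP => E; move: fj.
  by rewrite E gt0_muley ?lte_fin ?invr_gt0 ?hseq_gt0.
pose P t := al t * s' t.
have mP : measurable_fun setT P.
  apply: measurable_funM => //; apply: measurable_indic; exact: measurable_itv.
have itv_measure y j : mu `]y - hseq j, y[%classic = (hseq j)%:E.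
  rewrite lebesgue_measure_itv/= lte_fin ifT; last by rewrite ltrBlDr ltrDl hseq_gt0.
  by rewrite -EFinB opprB addrCA subrr addr0.
have be_int j : mu.-integrable setT (EFin \o be j) /\ \int[mu]_y be j y = hseq j.
  split; first exact: integrable_indic_itv.
  transitivity (fine (hseq j : R)%:E) => //; congr fine; rewrite integral_indic// setIT.
  exact: itv_measure.
(* A trace is not assumed integrable. It is so on (a, b) because |s| <= |f - s| + f on a single
   strip of width h_j for which [V j] is integrable. *)
have iP : mu.-integrable setT (EFin \o P).
  have [j iVj] : exists j, L1 (V j) by case: iV => N _ /(_ N (leqnn N)); exists N.
  have mPb : measurable_fun setT (fun z : R * R => P z.1 * be j z.2).
    apply: measurable_funM; last exact: mcd.
    exact: (measurableT_comp mP (@measurable_fst _ _ _ _)).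
  have iVf : L1 (fun z => V j z + f z) by exact: (integrableD measurableT iVj f_int).
  have iPb : L1 (fun z => P z.1 * be j z.2).
    apply: (integrable_le iVf mPb) => z.
    have /andP[a1 a2] := al01 z.1; have /andP[b1 b2] := be01 j z.2.
    have c1 : 0 <= al z.1 * be j z.2 by exact: mulr_ge0.
    have c2 : al z.1 * be j z.2 <= 1 by exact: mulr_ile1.
    have fz := density_ge0 T n z.
    have -> : P z.1 * be j z.2 = al z.1 * be j z.2 * s' z.1 by rewrite /P; ring.
    rewrite normrM (ger0_norm c1) /V.
    apply: (@le_trans _ _ (al z.1 * be j z.2 * (`|f z - s' z.1| + f z))).
      apply: ler_wpM2l => //; rewrite -[X in _ <= _ + X](ger0_norm fz).
      by rewrite addrC distrC -lerBlDl; apply: le_trans (ler_dist_dist _ _); exact: ler_norm.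
    by rewrite mulrDr lerD2l -[leRHS]mul1r ler_wpM2r.
  have mE : measurable_fun setT (EFin \o (fun z : R * R => P z.1 * be j z.2)).
    exact: (measurable_int mu2 iPb).
  have := (integrable12ltyP mu mu mE).1 iPb => /=.
  have -> : (fun t => \int[mu]_y `|(P t * be j y)%:E|)%E = (fun t => `|(P t)%:E| * (hseq
    j)%:E)%E.
    apply/funext => t; have [ib <-] := be_int j.
    rewrite -integral_Rintegral// -ge0_integralZl//; last 2 first.
    - exact: (measurable_int mu ib).
    - by move=> y _; rewrite lee_fin; have /andP[] := be01 j y.
    apply: eq_integral => y _; have /andP[b0 _] := be01 j y.
    by rewrite EFinM abseM [X in (_ * X)%E = _]gee0_abs.
  rewrite ge0_integralZr//; last 2 first.
  - by apply: measurableT_comp => //; exact/measurable_EFinP.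
  - by rewrite lee_fin ltW ?hseq_gt0.
  move=> H1; apply/integrableP; split; first exact/measurable_EFinP.
  rewrite ltey; apply/eqP => E; move: H1; rewrite E.
  by rewrite gt0_mulye ?lte_fin ?hseq_gt0.
split => //.
have EI j : \int[mu2]_z (al z.1 * be j z.2 * (f z - s' z.1)) =
    \int[mu]_y (be j y * slab_mass a b y) - hseq j * \int[mu]_t P t /\
  L1 (fun z => al z.1 * be j z.2 * (f z - s' z.1)).
  have [ib Ib] := be_int j.
  have iPb := integrable_tensor _ _ iP ib.
  have iF : L1 (fun z => be j z.2 * (al z.1 * f z)).
    have mm : measurable_fun setT (fun z : R * R => be j z.2 * (al z.1 * f z)).
      by apply: measurable_funM; [exact: mcd|apply: measurable_funM => //; exact: mab].
    apply: (integrable_le f_int mm) => z.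
    have /andP[a1 a2] := al01 z.1; have /andP[b1 b2] := be01 j z.2.
    have fz := density_ge0 T n z.
    rewrite ger0_norm ?mulr_ge0// mulrA -[leRHS]mul1r ler_wpM2r//.
    exact: mulr_ile1.
  have [_ EF _] := integrable_slice_x _ iF.
  have -> : (fun z => al z.1 * be j z.2 * (f z - s' z.1)) =
     (fun z => be j z.2 * (al z.1 * f z) - P z.1 * be j z.2).
    by apply/funext => z; rewrite /P; ring.
  split; last exact: (integrableB measurableT iF iPb).
  rewrite (RintegralB measurableT iF iPb) EF (Rintegral_tensor _ _ iP ib) Ib [X in _ - X]mulrC.
  congr (_ - _); apply: eq_Rintegral => y _ /=.
  rewrite /be indicE; case: (y \in _) => /=.
    by rewrite mul1r; apply: eq_Rintegral => t _; rewrite mul1r.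
  by rewrite mul0r /Rintegral; under eq_integral do rewrite mul0r; rewrite integral0.
have c1 : (hseq j)^-1 * \int[mu]_y (be j y * slab_mass a b y) - \int[mu]_t P t @[j -->
  \oo] --> (0 : R).
  apply/norm_cvg0P.
  have c0 := fine_cvg cV.
  apply: (@squeeze_cvgr _ _ _ _ (cst 0) (fine \o (fun j => ((hseq j)^-1%:E * \int[mu2]_z
    (V j z)%:E)%E))) => //.
    near=> j; have iVj : L1 (V j) by near: j.
    have [EIj iw] := EI j; have h0 := @hseq_gt0 R j.
    have hV0 : 0 <= (hseq j)^-1 :> R by rewrite invr_ge0 ltW.
    rewrite normr_ge0/= (integral_Rintegral iVj) -EFinM/=.
    have -> : (hseq j)^-1 * \int[mu]_y (be j y * slab_mass a b y) - \int[mu]_t P t =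
        (hseq j)^-1 * (\int[mu]_y (be j y * slab_mass a b y) - hseq j * \int[mu]_t P t).
      by rewrite mulrBr mulrA mulVf ?mul1r// gt_eqF.
    rewrite -EIj normrM (ger0_norm hV0) ler_wpM2l//.
    apply: (le_trans (le_normr_Rintegral measurableT iw)).
    apply: le_Rintegral => //; first exact: (integrable_norm iw).
    move=> z _; have /andP[a1 _] := al01 z.1; have /andP[b1 _] := be01 j z.2.
    by rewrite /V normrM (ger0_norm (mulr_ge0 a1 b1)).
  - exact: cvg_cst.
  - exact: c0.
have c2 : (hseq j)^-1 * \int[mu]_y (be j y * slab_mass a b y) @[j --> \oo] --> \int[mu]_t P t.
  apply/subr_cvg0; exact: c1.
pose E (y : R) j : set R := `]y - hseq j, y[%classic.
have hE y : nicely_shrinking y (E y).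
  apply: nicely_shrinking_itv => j; have h0 := @hseq_gt0 R j; split; lra.
have lw : locally_integrable setT (slab_mass a b).
  by apply: open_integrable_locally; [exact: openT|exact: slab_mass_integrable].
have c3 := nice_lebesgue_differentiation hE lw lx.
have c4 : ((mu (E x j))^-1 * \int[mu]_(y in E x j) (slab_mass a b y)%:E)%E @[j --> \oo]
  --> (\int[mu]_t P t)%:E.
  have Ej j : ((mu (E x j))^-1 * \int[mu]_(y in E x j) (slab_mass a b y)%:E)%E =
      ((hseq j)^-1 * \int[mu]_y (be j y * slab_mass a b y))%:E.
    have h0 := @hseq_gt0 R j; have [ib _] := be_int j.
    rewrite /E itv_measure inver gt_eqF// EFinM; congr (_ * _)%E.
    rewrite -integral_Rintegral; last first.
      have mm : measurable_fun setT (fun y => be j y * slab_mass a b y).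
        apply: measurable_funM; first by apply/measurable_EFinP; exact: (measurable_int mu ib).
        by apply/measurable_EFinP; exact: (measurable_int mu (slab_mass_integrable a b)).
      have is_ := integrable_norm (slab_mass_integrable a b).
      apply: (integrable_le is_ mm) => y; have /andP[b1 b2] := be01 j y.
      by rewrite normrM (ger0_norm b1) -[leRHS]mul1r ler_wpM2r.
    rewrite [LHS]integral_mkcond; apply: eq_integral => y _.
    rewrite patchE /be indicE /E; case: ifP => _; first by rewrite mul1r.
    by rewrite mul0r.
  under eq_fun do rewrite Ej.
  by apply: cvg_EFin; [exact: nearW|exact: c2].
by have [] : (slab_mass a b x)%:E = (\int[mu]_t P t)%:E by exact: (cvg_unique _ c3 c4).
Unshelve. all: by end_near. Qed.

End slice_traces.

(** Tonelli for a null set: the measures of its sections integrate to 0, so almost all sections are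
    null. *)
Lemma ae_slices {R : realType} (P : R * R -> Prop) :
  {ae ((@lebesgue_measure R) \x (@lebesgue_measure R))%E, forall z, P z} ->
  {ae @lebesgue_measure R, forall t, {ae @lebesgue_measure R, forall x, P (t, x)}}.
Proof.
set mu := @lebesgue_measure R; move=> [N [mN N0 sN]].
have mX := measurable_fun_xsection mu mN.
have : (\int[mu]_t `|mu (xsection N t)| = 0)%E.
  by rewrite -[RHS]N0; apply: eq_integral => t _; rewrite gee0_abs.
move=> /(ae_eq_integral_abs _ measurableT mX).1.
apply: (@filterS _ _ (ae_filter_ringOfSetsType mu)) => t /(_ I) Nt.
exists (xsection N t); split => //; first exact: measurable_xsection.
by move=> x Px; rewrite /xsection/= inE; exact: sN.
Qed.

(** * Limits at infinity and at x = 0, and the mass of a time slice *)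

Section trace_limits.
Context {R : realType}.
Local Notation mu := (@lebesgue_measure R).
Local Notation mu2 := (mu \x mu)%E.
Local Notation L1 u := (mu2.-integrable setT (EFin \o u)).
Variables (T : R) (n : R -> R -> R).
Hypothesis n_int : mu2.-integrable (`[0, T] `*` `[0, +oo[) (fun z => (n z.1 z.2)%:E).
Hypothesis n_ge0 : nonnegative n.
Local Notation f := (density T n).

Let f_int : L1 f. Proof. exact: density_integrable. Qed.

Let mf : measurable_fun setT f.
Proof. by apply/measurable_EFinP; exact: (measurable_int mu2 f_int). Qed.

(* Both sides have the same integral over every interval with rational endpoints:
   for fixed endpoints this holds at every Lebesgue point [x] of the slab mass. *)
Lemma slice_eq_trace (tr : R -> R -> R) :
  (forall r, 0 < r -> left_trace T n r (tr r)) ->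
  {ae mu, forall x, 0 < x -> {ae mu, forall t, 0 < t < T -> f (t, x) = tr x t}}.
Proof.
move=> Htr.
(* Only countably many slabs occur, so one null set of x serves for all of them. *)
have aeL : {ae mu, forall x, forall pq : rat * rat,
    lebesgue_pt (slab_mass T n (ratr pq.1) (ratr pq.2)) x}.
  apply: ae_forall_countable => -[p q]; apply: lebesgue_differentiation.
  by apply: open_integrable_locally; [exact: openT|exact: slab_mass_integrable].
have [_ _ aeI] := integrable_slice_x _ f_int.
apply: (@filterS2 _ _ (ae_filter_ringOfSetsType mu)) aeL aeI => x lx ix x0.
have tx := Htr x x0; have [ms _] := tx.
set s' := tr x \_ `]0, T[.
have ms' : measurable_fun setT s' by apply/(measurable_restrictT _ _).1.
pose w (pq : rat * rat) t : R := \1_(`]ratr pq.1, ratr pq.2[) t * (f (t, x) - s' t).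
have key (p q : rat) : 0 < ratr p :> R -> ratr p < ratr q :> R -> ratr q < T ->
   mu.-integrable setT (EFin \o w (p, q)) /\ \int[mu]_t w (p, q) t = 0.
  move=> p0 pq qT.
  have [iP EP] := slab_mass_trace T n n_int n_ge0 (tr x) _ _ _ p0 pq qT x0 tx (lx (p, q)).
  have iF : mu.-integrable setT (EFin \o (fun t => \1_(`]ratr p, ratr q[) t * f (t, x))).
    have mfx : measurable_fun setT (fun t : R => f (t, x)).
      by apply/measurable_EFinP; exact: (measurable_int mu ix).
    have mm : measurable_fun setT (fun t : R => \1_(`]ratr p, ratr q[) t * f (t, x)).
      by apply: measurable_funM => //; apply: measurable_indic; exact: measurable_itv.
    apply: (integrable_le ix mm) => t.
    have fz := density_ge0 T n (t, x).
    rewrite normrM (ger0_norm fz) indicE -[leRHS]mul1r ler_wpM2r//.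
    by case: (_ \in _); rewrite ?normr1 ?normr0.
  have -> : w (p, q) = fun t => \1_(`]ratr p, ratr q[) t * f (t, x) - \1_(`]ratr p, ratr
    q[) t * s' t.
    by apply/funext => t; rewrite /w mulrBr.
  split; first exact: (integrableB measurableT iF iP).
  by rewrite (RintegralB measurableT iF iP) -EP subrr.
have aeW : {ae mu, forall t, forall pq : rat * rat, 0 < ratr pq.1 :> R -> ratr pq.2 < T ->
    ratr pq.1 < t < ratr pq.2 -> w pq t = 0}.
  apply: ae_forall_countable => -[p q] /=.
  have [pq|pq] := ltP (ratr p : R) (ratr q); last first.
    apply: aeW => t _ _ /andP[pt tq]; exfalso.
    by have := lt_le_trans (lt_trans pt tq) pq; rewrite ltxx.
  have [p0|p0] := ltP 0 (ratr p : R); last by apply: aeW.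
  have [qT|qT] := ltP (ratr q) T; last by apply: aeW.
  have [iw _] := key p q p0 pq qT.
  have := @ae_zero_of_rational_integrals _ _ (ratr p) (ratr q) iw.
  case; last by move=> N [mN N0 sN]; exists N; split=> // t Ht; apply: sN => H; apply: Ht
    => _ _; exact: H.
  move=> p' q' pp' qq'; have [pq'|pq'] := ltP (ratr p' : R) (ratr q'); last first.
    by rewrite set_itv_ge ?integral_set0// -leNgt bnd_simp.
  have [iw' w'0] := key p' q' (lt_trans p0 pp') pq' (lt_trans qq' qT).
  have : (\int[mu]_t (w (p', q') t)%:E = 0)%E by rewrite integral_Rintegral// w'0.
  move=> w''; rewrite -[RHS]w'' [LHS]integral_mkcond; apply: eq_integral => t _.
  rewrite patchE /w /= !indicE; case: ifPn => [|_]; last by rewrite mul0r.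
  rewrite inE/= in_itv/= => /andP[pt tq]; rewrite mem_set ?mul1r//=.
  by rewrite in_itv/= (lt_trans pp' pt) (lt_trans tq qq').
apply: (@filterS _ _ (ae_filter_ringOfSetsType mu)) aeW => t Ht /andP[t0 tT].
(* Traces give information on compact subintervals of (0, T) only; rational ones cover every t in
   (0, T). *)
have /rat_in_itvoo[p /itvP hp] := t0; have /rat_in_itvoo[q /itvP hq] := tT.
have p0 : 0 < ratr p :> R by rewrite hp.
have qT : ratr q < T by rewrite hq.
have ptq : ratr p < t < ratr q by rewrite hp hq.
have := Ht (p, q) p0 qT ptq; rewrite /w indicE mem_set/= ?in_itv//= mul1r.
move=> /eqP; rewrite subr_eq0 => /eqP ->.
by rewrite /s' patchE mem_set//= in_itv/= t0.
Qed.


Variables (S : R -> R) (C : R).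
Hypothesis HS : step_function S C.
Variables (th : R -> R) (a b : R).
Hypothesis th_smooth : smooth th.
Hypothesis th01 : forall t, 0 <= th t <= 1.
Hypothesis a0 : 0 < a.
Hypothesis ab : a < b.
Hypothesis bT : b < T.
Hypothesis thS : forall t, th t != 0 -> a < t < b.

Let mth : measurable_fun setT (fun z : R * R => th z.1).
Proof. exact: (measurableT_comp (smooth_measurable _ th_smooth) (@measurable_fst _ _ _ _)). Qed.

Let m2 (u : R -> R) : measurable_fun setT u ->
  measurable_fun setT (fun z : R * R => u z.2).
Proof. by move=> mu_; exact: (measurableT_comp mu_ (@measurable_snd _ _ _ _)). Qed.

Lemma smooth_rise' h : smooth (rise' S h).
Proof. by rewrite -(derive1_rise _ _ HS); apply: smooth_derive1; exact: smooth_rise HS _. Qed.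

Lemma fall'_measurable r : measurable_fun setT (fall' S r).
Proof.
by apply/measurable_EFinP; exact: (measurable_int mu (integral_fall' _ _ HS r).1).
Qed.

Let mflux : measurable_fun setT (fun z : R * R => flux z.2 (f z)).
Proof.
have mx : measurable_fun setT (fun z : R * R => z.2) by exact: measurable_snd.
apply: measurable_funB; last exact: measurable_funX.
apply: measurable_funM => //; apply: measurable_funB; last exact: measurable_funX.
by apply: measurable_funM => //; exact: measurable_cst.
Qed.

(** For almost every x the slice of f equals the trace there, so beyond some threshold its flux,
    integrated in time, is at most e. The weight [fall'] has integral 1 and charges only x > r_j;
    averaging over x is what makes an identity at almost every x sufficient. *)
Lemma far_flux : no_flux_at_infinity T n ->
  \int[mu2]_z (flux z.2 (f z) * (th z.1 * fall' S (rseq j) z.2)) @[j --> \oo] --> (0 : R).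
Proof.
move=> [tr [Htr Hfl]]; have Hs := slice_eq_trace tr Htr.
apply/cvgr0Pnorm_le => e e0.
have [M [_ HM]] : \forall r \near +oo, (\int[mu]_(t in `[0%R, T]) `|flux r (tr r t)|%:E
  <= e%:E)%E.
  have fin := cvg_is_fine Hfl.
  have Hf : (fine \o (fun r => \int[mu]_(t in `[0%R, T]) `|flux r (tr r t)|%:E)%E) r @[r
    --> +oo] --> (0 : R).
    exact: fine_cvg Hfl.
  move/cvgr0Pnorm_le: Hf => /(_ e e0) Hf.
  apply: filterS2 fin Hf => r fr er; rewrite -(fineK fr) lee_fin.
  exact: le_trans (ler_norm _) er.
near=> j; have rM : M < rseq j by near: j; exact: near_rseq_gt.
pose F (z : R * R) := flux z.2 (f z) * (th z.1 * fall' S (rseq j) z.2).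
have mF : measurable_fun setT F.
  apply: measurable_funM => //; apply: measurable_funM => //.
  by apply: m2; exact: fall'_measurable.
have mAF : measurable_fun setT (fun z : R * R => `|(F z)%:E|%E).
  by apply: measurableT_comp => //; exact/measurable_EFinP.
have [iB IB] := integral_fall' _ _ HS (rseq j).
(* With absolute values in [\bar R], Tonelli applies without prior integrability of [F]. *)
suff : (\int[mu2]_z `|(F z)%:E| <= e%:E)%E.
  move=> H; rewrite -lee_fin; apply: le_trans H.
  apply: (le_trans (abse_fine_le _)); apply: le_abse_integral => //.
  exact/measurable_EFinP.
rewrite (fubini_tonelli2 (m1 := mu) (m2 := mu) _ mAF)//.
have -> : e%:E = (\int[mu]_x (e * fall' S (rseq j) x)%:E)%E.
  have ieB : mu.-integrable setT (EFin \o (fun x => e * fall' S (rseq j) x)).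
    exact: (integrableZl measurableT e iB).
  by rewrite (integral_Rintegral ieB) RintegralZl// IB mulr1.
apply: ae_ge0_le_integral => //.
- by move=> x _; exact: integral_ge0.
- exact: (measurable_fun_fubini_tonelli_G (m1 := mu) (fun z => `|(F z)%:E|%E) mAF).
- by move=> x _; rewrite lee_fin mulr_ge0 ?(ltW e0)// (fall'_ge0 _ _ HS).
- apply/measurable_EFinP; apply: measurable_funM; first exact: measurable_cst.
  exact: fall'_measurable.
apply: (@filterS _ _ (ae_filter_ringOfSetsType mu)) Hs => x Hx _.
have B0 := fall'_ge0 _ _ HS (rseq j) x.
rewrite /fubini_G /F /=.
have [E|Bx] := eqVneq (fall' S (rseq j) x) 0.
  by under eq_integral do rewrite E !mulr0 normr0; rewrite integral0 E mulr0.
have /andP[rx _] := fall'_supp _ _ HS _ _ Bx.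
have x0 : 0 < x by apply: lt_trans rx; rewrite ltr0n.
have {}Hx := Hx x0.
have He := HM x (lt_trans rM rx).
have [mtr _] := Htr x x0.
have mfx : measurable_fun setT (fun t : R => f (t, x)).
  by apply: (measurableT_comp mf); exact: pair2_measurable.
have mfluxx (D : set R) (u : R -> R) : measurable_fun D u ->
    measurable_fun D (fun t => `|flux x (u t)|).
  move=> mu_; have H : measurable_fun D (fun t => flux x (u t)).
    apply: measurable_funB; last exact: measurable_funX.
    by apply: measurable_funM => //; exact: measurable_cst.
  exact: (measurableT_comp (@normr_measurable R setT) H).
have mth1 : measurable_fun setT th by exact: smooth_measurable.
have -> : (\int[mu]_t `|(flux x (f (t, x)) * (th t * fall' S (rseq j) x))%:E| =
    (fall' S (rseq j) x)%:E * \int[mu]_t (th t * `|flux x (f (t, x))|)%:E)%E.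
  rewrite -ge0_integralZl//; last 2 first.
  - by apply/measurable_EFinP; apply: measurable_funM => //; exact: mfluxx.
  - by move=> t _; rewrite lee_fin mulr_ge0//; have /andP[] := th01 t.
  apply: eq_integral => t _; have /andP[t0 _] := th01 t.
  rewrite abse_EFin -EFinM; congr (_%:E).
  by rewrite !normrM (ger0_norm t0) (ger0_norm B0) mulrCA mulrA mulrC.
rewrite mulrC EFinM; apply: lee_pmul => //.
  by apply: integral_ge0 => t _; rewrite lee_fin mulr_ge0//; have /andP[] := th01 t.
apply: le_trans He.
apply: (@le_trans _ _ (\int[mu]_(t in `]0%R, T[) `|flux x (tr x t)|%:E)%E); last first.
  apply: ge0_subset_integral => //.
    apply/measurable_EFinP; apply: mfluxx.
    exact: (@measurable_fun_itv_cc _ _ _ false true).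
  by move=> t /=; rewrite !in_itv/= => /andP[? ?]; rewrite !ltW.
have -> : (\int[mu]_t (th t * `|flux x (f (t, x))|)%:E =
    \int[mu]_(t in `]0%R, T[) (th t * `|flux x (f (t, x))|)%:E)%E.
  rewrite [RHS]integral_mkcond; apply: eq_integral => t _; rewrite patchE.
  case: ifPn => //; rewrite notin_setE/= in_itv/= => tT.
  have -> : th t = 0; last by rewrite mul0r.
  apply/eqP/negPn/negP => /thS/andP[at_ tb]; apply: tT.
  by rewrite (lt_trans a0 at_) (lt_trans tb bT).
apply: ae_ge0_le_integral => //.
- by move=> t _; rewrite lee_fin mulr_ge0//; have /andP[] := th01 t.
- apply: measurable_funTS; apply/measurable_EFinP.
  by apply: measurable_funM => //; exact: mfluxx.
- by apply/measurable_EFinP; exact: mfluxx.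
apply: (@filterS _ _ (ae_filter_ringOfSetsType mu)) Hx => t Ht.
rewrite /= in_itv/= => /Ht ->; have /andP[_ t1] := th01 t.
by rewrite lee_fin -[leRHS]mul1r ler_wpM2r.
Unshelve. all: by end_near. Qed.

(** The kernel is at most C / h on (a, b) x (0, h) and 0 elsewhere, so C times the trace averages
    dominate. It matters that 0 < a and b < T, as a trace gives no control up to the ends of (0,
    T). *)
Lemma right_trace_weighted (g : R -> R) : right_trace T n 0 g ->
  (\int[mu2]_z (th z.1 * rise' S (hseq j) z.2 * `|f z - (g \_ `]0, T[) z.1|)%:E)%E
    @[j --> \oo] --> 0%E.
Proof.
move=> [mg /(_ a b a0 ab bT)]; set g' := g \_ _ => H.
have mg' : measurable_fun setT g' by apply/(measurable_restrictT _ _).1.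
have mfg : measurable_fun setT (fun z : R * R => `|f z - g' z.1|).
  have mfg : measurable_fun setT (fun z : R * R => f z - g' z.1).
    apply: measurable_funB => //.
    exact: (measurableT_comp mg' (@measurable_fst _ _ _ _)).
  exact: (measurableT_comp (@normr_measurable R setT) mfg).
have H1 := (cvge_at_rightP _ _ _).1 H (@hseq R) (conj (@hseq_gt0 R) hseq_cvg0).
have C0 := step_slope_ge0 _ _ HS.
have H2 : (C%:E * ((hseq j)^-1%:E * \int[mu2]_(z in `]a, b[ `*` `]0%R, (0 + hseq j)%R[)
    `|n z.1 z.2 - g z.1|%:E))%E @[j --> \oo] --> 0%E.
  by rewrite -(mule0 C%:E); exact: cvgeZl H1.
apply: (squeeze_cvge _ (cvg_cst 0%E) H2).
apply: nearW => j; have h0 := @hseq_gt0 R j.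
have mA : measurable_fun setT (fun z : R * R => rise' S (hseq j) z.2).
  by apply: m2; apply: smooth_measurable; exact: smooth_rise'.
have [t0 A0] : (forall t, 0 <= th t) /\ (forall x, 0 <= rise' S (hseq j) x).
  split; first by move=> t; have /andP[] := th01 t.
  by move=> x; exact: (rise'_ge0 _ _ HS).
have mab (c d : R) : measurable_fun setT (\1_(`]c, d[) : R -> R).
  by apply: measurable_indic; exact: measurable_itv.
apply/andP; split.
  by apply: integral_ge0 => z _; rewrite lee_fin; exact: (mulr_ge0 (mulr_ge0 (t0 _) (A0 _))).
rewrite (box_integral T n n_int n_ge0 g a b 0 (0 + hseq j) mg (ltW a0) (ltW bT) (lexx 0))
  add0r muleA -EFinM.
have mV : measurable_fun setT (fun z : R * R => \1_(`]a, b[) z.1 * \1_(`]0, hseq j[) z.2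
  * `|f z - g' z.1|).
  apply: measurable_funM => //; apply: measurable_funM; last exact: m2.
  exact: (measurableT_comp (mab _ _) (@measurable_fst _ _ _ _)).
rewrite -ge0_integralZl//; last 2 first.
- exact/measurable_EFinP.
- by rewrite lee_fin mulr_ge0// invr_ge0 ltW.
apply: ge0_le_integral => //.
- by move=> z _; rewrite lee_fin; exact: (mulr_ge0 (mulr_ge0 (t0 _) (A0 _))).
- apply/measurable_EFinP; apply: measurable_funM => //; exact: measurable_funM.
- by apply/measurable_EFinP; apply: measurable_funM => //; exact: measurable_cst.
move=> z _; rewrite -EFinM lee_fin [leRHS]mulrA; apply: ler_wpM2r => //.
have R0 : 0 <= C / hseq j * (\1_`]a, b[ z.1 * \1_`]0, hseq j[ z.2).
  by rewrite !mulr_ge0// ?invr_ge0 ?indicE// ltW.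
have [->|tz] := eqVneq (th z.1) 0; first by rewrite mul0r.
have [->|Az] := eqVneq (rise' S (hseq j) z.2) 0; first by rewrite mulr0.
rewrite !indicE !mem_set/= ?in_itv/=; [|exact: (rise'_supp _ _ HS)|exact: thS].
rewrite !mulr1 -[leRHS]mul1r; have /andP[_ t1] := th01 z.1.
by apply: ler_pM => //; exact: (rise'_le _ _ HS).
Qed.

(** The weak formulation sees the mass of f for almost every t, whereas continuity in time, hence
    the values at 0 and T, belongs to m. This links the two. *)
Lemma mass_identity (m : R -> R -> R) : L1_continuous_version n m ->
  mu.-integrable setT (EFin \o (fun t => \int[mu]_x f (t, x))) /\
  {ae mu, forall t, 0 < t < T ->
     \int[mu]_x f (t, x) = \int[mu]_(x in `]0, +oo[) m t x}.
Proof.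
move=> [m_eq m_int _].
have [iM _ iX] := integrable_slice_t _ f_int; split=> //.
have A := ae_slices _ (density_ae T n n_ge0).
have AB := @filterS2 _ _ (ae_filter_ringOfSetsType mu) _ _ _ _ A m_eq.
have {A AB} : {ae mu, forall t, 0 < t < T -> {ae mu, forall x, 0 < x -> m t x = f (t, x)}}.
  apply: AB => t Hf Hm /andP[t0 tT].
  apply: (@filterS2 _ _ (ae_filter_ringOfSetsType mu)) Hf (Hm t0) => x fx mx x0.
  by rewrite mx// fx//; split; rewrite /= in_itv/= ?t0// x0.
have F2 := @filterS2 _ _ (ae_filter_ringOfSetsType mu).
move=> H; apply: F2 H iX => t Ht it tT.
have t0 : 0 <= t by have /andP[/ltW] := tT.
have it' : mu.-integrable setT (EFin \o (fun x => f (t, x))) by [].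
have -> : \int[mu]_x f (t, x) = \int[mu]_(x in `]0, +oo[) f (t, x).
  rewrite [RHS]Rintegral_mkcond; apply: eq_Rintegral => x _; rewrite patchE.
  case: ifPn => //; rewrite notin_setE/= in_itv/= andbT => /negP; rewrite -leNgt => x0.
  by rewrite density_supp.
rewrite /Rintegral; congr fine; apply: ae_eq_integral => //.
- by apply: measurable_funTS; exact: (measurable_int mu it').
- exact: (measurable_int mu (m_int t t0)).
apply: (@filterS _ _ (ae_filter_ringOfSetsType mu)) (Ht tT) => x Hx.
by rewrite /= in_itv/= andbT => /Hx ->.
Qed.

End trace_limits.

(** * Mass balance *)

Section time_windows.
Context {R : realType}.
Local Notation mu := (@lebesgue_measure R).
Variables (S : R -> R) (C : R).
Hypothesis HS : step_function S C.
Variables (T h : R).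
Hypothesis h0 : 0 < h.
Hypothesis hT : h + h <= T.

Definition window (t : R) : R := rise S h t * rise S h (T - t).

Let fallW := fun t : R => rise S h (-1 * t + T).

Let fallWE t : rise S h (T - t) = fallW t.
Proof. by rewrite /fallW mulN1r addrC. Qed.

Let windowE : window = rise S h \* fallW.
Proof. by apply/funext => t; rewrite /window fallWE. Qed.

Let is_derive_fallW (t : R) : is_derive t 1 fallW (- rise' S h (T - t)).
Proof.
have -> : - rise' S h (T - t) = -1 * derive1 (rise S h) (-1 * t + T).
  by rewrite (derive1_rise _ _ HS) !mulN1r addrC.
apply: is_derive_affine; apply: smooth_derivable; exact: smooth_rise HS _.
Qed.

Let smooth_fallW : smooth fallW.
Proof. apply: smooth_affine; exact: smooth_rise HS _. Qed.

Lemma smooth_window : smooth window.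
Proof. by rewrite windowE; apply: smoothM => //; exact: smooth_rise HS _. Qed.

(** As h + h <= T, each slope lives where the other factor is already 1. *)
Lemma derive1_window t : derive1 window t = rise' S h t - rise' S h (T - t).
Proof.
have -> : derive1 window t = rise' S h t * rise S h (T - t) - rise S h t * rise' S h (T - t).
  rewrite windowE derive1E; apply: derive_val.
  refine (is_derive_eq (is_deriveM (is_derive_rise _ _ HS h t) (is_derive_fallW t)) _).
  by rewrite /GRing.scale/= fallWE; ring.
congr (_ - _).
  have [->|/(rise'_supp _ _ HS _ _ h0)/andP[_ th]] := eqVneq (rise' S h t) 0.
    by rewrite mul0r.
  by rewrite (rise1 _ _ HS)// ?mulr1// lerBrDr; apply: le_trans hT; rewrite lerD2l ltW.
have [->|/(rise'_supp _ _ HS _ _ h0)/andP[_ th]] := eqVneq (rise' S h (T - t)) 0.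
  by rewrite mulr0.
by rewrite (rise1 _ _ HS)// ?mul1r// -(lerD2l h) (le_trans hT)// -lerBlDr ltW.
Qed.

Lemma window01 t : 0 <= window t <= 1.
Proof.
have /andP[a0 a1] := step01 _ _ HS (h^-1 * t); have /andP[b0 b1] := step01 _ _ HS (h^-1 *
  (T - t)).
by rewrite mulr_ge0//= mulr_ile1.
Qed.

(** The margin keeps the support in a compact part of (0, T), as test functions and traces require.
    Any margin up to h / 4 works, since S vanishes up to 1/4. *)
Lemma window_supp t : window t != 0 -> h / 8 < t < T - h / 8.
Proof.
have h0' := h0; have hT' := hT.
have rise_supp x : rise S h x != 0 -> h / 8 < x.
  rewrite ltNge; apply: contra => xh; apply/eqP; rewrite /rise (step0 _ _ HS _ _).1//.
  by rewrite ler_pdivrMl//; lra.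
by rewrite mulf_eq0 negb_or => /andP[/rise_supp h1 /rise_supp h2]; lra.
Qed.

Lemma window'_le t : `|derive1 window t| <= 2 * (C / h).
Proof.
rewrite derive1_window; have h0' := h0.
have a0 := rise'_ge0 _ _ HS _ t h0; have a1 := rise'_le _ _ HS _ t h0.
have b0 := rise'_ge0 _ _ HS _ (T - t) h0; have b1 := rise'_le _ _ HS _ (T - t) h0.
by rewrite ler_norml; lra.
Qed.

Lemma window_integrable : mu.-integrable setT (EFin \o window).
Proof.
apply: (continuous_supp_integrable _ (h / 8) (T - h / 8)).
  exact: smooth_continuous smooth_window.
by move=> t; apply: contraNeq => /window_supp/andP[a b]; rewrite !ltW.
Qed.

Lemma integral_window' : mu.-integrable setT (EFin \o derive1 window) /\
  \int[mu]_t derive1 window t = 0.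
Proof.
have h0' := h0; have hT' := hT; have T0 : 0 < T by lra.
have [|i ->] := integral_derive1 _ 0 T T0 smooth_window.
  have wS t : window t != 0 -> h / 8 <= t <= T - h / 8.
    by move=> /window_supp/andP[a b]; rewrite !ltW.
  move=> t; apply: contraNeq => /(derive1_supp _ _ _ wS); lra.
by split=> //; rewrite /window subrr subr0 !(rise0 _ _ HS _ _ h0 (lexx 0)) mulr0 mul0r subr0.
Qed.

Lemma integral_rise'_reflect :
  mu.-integrable setT (EFin \o (fun t => rise' S h (T - t))) /\
  \int[mu]_t rise' S h (T - t) = 1.
Proof.
have h0' := h0; have hT' := hT.
have E : (fun t => rise' S h (T - t)) = fun t => -1 * derive1 fallW t.
  by rewrite (derive1_ext _ _ is_derive_fallW); apply/funext => t; rewrite mulN1r opprK.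
have [|||i1 I1] := integral_derive1 fallW 0 T; first by lra.
- exact: smooth_fallW.
- move=> t; rewrite (derive1_ext _ _ is_derive_fallW) => H.
  by apply/eqP; rewrite oppr_eq0; apply: contraNT H => /(rise'_supp _ _ HS _ _ h0); lra.
split; first by rewrite E; exact: (integrableZl measurableT (-1) i1).
rewrite E RintegralZl// I1 /fallW mulr0 add0r mulN1r addNr.
rewrite (rise0 _ _ HS _ _ h0 (lexx 0)) (rise1 _ _ HS)//; last by lra.
by rewrite sub0r mulN1r opprK.
Qed.

End time_windows.

(** An approximate identity. Closeness to c is asked only almost everywhere on the support of the
    kernel, because the mass of f agrees with the continuous one for almost every t only. *)
Lemma cvg_kernel_integral {R : realType} (ka : nat -> R -> R) (M : R -> R) (c : R) :
  let mu := @lebesgue_measure R in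
  (forall j, mu.-integrable setT (EFin \o ka j) /\ \int[mu]_t ka j t = 1) ->
  (forall j t, 0 <= ka j t) ->
  (forall j, mu.-integrable setT (EFin \o (fun t => ka j t * M t))) ->
  (forall e, 0 < e -> \forall j \near \oo,
     {ae mu, forall t, ka j t != 0 -> `|M t - c| <= e}) ->
  \int[mu]_t (ka j t * M t) @[j --> \oo] --> c.
Proof.
move=> mu ik k0 ikM HM; apply/cvgrPdist_le => e e0.
have := HM e e0; apply: filterS => j Hj.
have [ij Ij] := ik j.
have ijc : mu.-integrable setT (EFin \o (fun t => c * ka j t)).
  exact: (integrableZl measurableT c ij).
have iejk : mu.-integrable setT (EFin \o (fun t => e * ka j t)).
  exact: (integrableZl measurableT e ij).
have iw : mu.-integrable setT (EFin \o (fun t => ka j t * M t - c * ka j t)).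
  exact: (integrableB measurableT (ikM j) ijc).
have -> : c - \int[mu]_t (ka j t * M t) = - \int[mu]_t (ka j t * M t - c * ka j t).
  by rewrite (RintegralB measurableT (ikM j) ijc) RintegralZl// Ij mulr1 opprB.
have mw := measurable_int mu iw.
rewrite normrN -lee_fin; apply: (le_trans (abse_fine_le _)).
apply: (le_trans (le_abse_integral mu measurableT mw)).
have -> : e%:E = (\int[mu]_t (e * ka j t)%:E)%E.
  by rewrite (integral_Rintegral iejk) RintegralZl// Ij mulr1.
apply: ae_ge0_le_integral => //.
- exact: measurableT_comp.
- by move=> t _; rewrite lee_fin mulr_ge0// ltW.
- exact: (measurable_int mu iejk).
apply: (@filterS _ _ (ae_filter_ringOfSetsType mu)) Hj => t Ht _.
rewrite /= lee_fin (mulrC c) -mulrBr normrM (ger0_norm (k0 _ _)) mulrC.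
have [->|kt] := eqVneq (ka j t) 0; first by rewrite !mulr0.
by rewrite ler_wpM2r// Ht.
Qed.

(** * Passage to the limit in time *)

Section mass_balance.
Context {R : realType}.
Local Notation mu := (@lebesgue_measure R).
Local Notation mu2 := (mu \x mu)%E.
Variables (n m : R -> R -> R) (T : R).
Hypothesis T0 : 0 < T.
Hypothesis n_sol : entropy_solution T n.
Hypothesis n_ge0 : nonnegative n.
Hypothesis m_version : L1_continuous_version n m.
Variable g : R -> R.
Hypothesis g_trace : right_trace T n 0 g.
Local Notation f := (density T n).
Local Notation g' := (g \_ `]0, T[).

Definition total_mass (t : R) : R := \int[mu]_(x in `]0, +oo[) m t x.

Let n_int : mu2.-integrable (`[0, T] `*` `[0, +oo[) (fun z => (n z.1 z.2)%:E).
Proof. by case: n_sol. Qed.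

Let f_int : mu2.-integrable setT (EFin \o f). Proof. exact: density_integrable. Qed.

Let M t : R := \int[mu]_x f (t, x).

Let mg' : measurable_fun setT g'.
Proof. by apply/(measurable_restrictT _ _).1 => //; case: g_trace. Qed.

(** This is [flux_trace_identity] with the window as time cutoff. Fubini turns its right-hand side
    into the mass integrated against the slope of the window, that is, an average near 0 minus an
    average near T. *)
Lemma flux_window (S : R -> R) (C h : R) : step_function S C -> 0 < h -> h + h <= T ->
  [/\ mu.-integrable setT (EFin \o (fun t => rise' S h t * M t)),
      mu.-integrable setT (EFin \o (fun t => rise' S h (T - t) * M t)) &
  (\int[mu]_t (window S T h t * g' t ^+ 2)%:E =
   (\int[mu]_t (rise' S h t * M t) - \int[mu]_t (rise' S h (T - t) * M t))%:E)%E].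
Proof.
move=> HS h0 hT.
have [_ _ wk ent noflux] := n_sol.
have sth := smooth_window _ _ HS T h.
have th01 := window01 _ _ HS T h.
have thS t : window S T h t != 0 -> h / 8 < t < T - h / 8 := window_supp _ _ HS T h h0 hT t.
have thS' t : window S T h t != 0 -> h / 8 <= t <= T - h / 8.
  by move=> /thS/andP[a b]; rewrite !ltW.
have a0 : 0 < h / 8 by rewrite divr_gt0.
have ab : h / 8 < T - h / 8 by lra.
have bT : T - h / 8 < T by lra.
have [th'_int th'_0] := integral_window' _ _ HS T h h0 hT.
have E := flux_trace_identity _ _ HS f (window S T h) (2 * (C / h)) f_int
  (density_ge0 T n) (density_supp T n) sth th01
  (window'_le _ _ HS T h h0 hT) (window_integrable _ _ HS T h h0 hT) th'_int th'_0.
have [iM _ _] := integrable_slice_t _ f_int.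
have [iT1 IT1] := integral_rise' _ _ HS h h0.
have [iT2 IT2] := integral_rise'_reflect _ _ HS T h h0 hT.
have bM (ka : R -> R) : mu.-integrable setT (EFin \o ka) -> (forall t, 0 <= ka t <= C / h) ->
    mu.-integrable setT (EFin \o (fun t => ka t * M t)).
  move=> ik k0.
  have iCM : mu.-integrable setT (EFin \o (fun t => C / h * `|M t|)).
    exact: (integrableZl measurableT (C / h) (integrable_norm iM)).
  have mm : measurable_fun setT (fun t : R => ka t * M t).
    apply: measurable_funM; first by apply/measurable_EFinP; exact: (measurable_int mu ik).
    by apply/measurable_EFinP; exact: (measurable_int mu iM).
  apply: (integrable_le iCM mm) => t; have /andP[k1 k2] := k0 t.
  by rewrite normrM (ger0_norm k1) ler_wpM2r.
have b1 : mu.-integrable setT (EFin \o (fun t => rise' S h t * M t)).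
  by apply: bM => // t; rewrite (rise'_ge0 _ _ HS)// (rise'_le _ _ HS).
have b2 : mu.-integrable setT (EFin \o (fun t => rise' S h (T - t) * M t)).
  by apply: bM => // t; rewrite (rise'_ge0 _ _ HS)// (rise'_le _ _ HS).
split=> //; rewrite {}E//.
- congr (_%:E); rewrite -(RintegralB measurableT b1 b2).
  have iF : mu2.-integrable setT (EFin \o (fun z => f z * derive1 (window S T h) z.1)).
    apply: (integrable_bounded_mul f f_int (density_ge0 T n) _ (2 * (C / h))).
      apply: (measurableT_comp _ (@measurable_fst _ _ _ _)).
      exact: smooth_measurable (smooth_derive1 _ sth).
    by move=> z; exact: window'_le _ _ HS T h h0 hT z.1.
  have [iS -> _] := integrable_slice_t _ iF.
  have [_ _ ae2] := integrable_slice_t _ f_int.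
  rewrite /Rintegral; congr fine; apply: ae_eq_integral => //.
  + exact: (measurable_int mu iS).
  + exact: (measurable_int mu (integrableB measurableT b1 b2)).
  apply: (@filterS _ _ (ae_filter_ringOfSetsType mu)) ae2 => t it _.
  have HM : \int[mu]_x (f (t, x) * derive1 (window S T h) t) = M t * derive1 (window S T h) t.
    by rewrite RintegralZr.
  rewrite /=; congr (_%:E); transitivity (M t * derive1 (window S T h) t); first exact: HM.
  by rewrite (derive1_window _ _ HS T h h0 hT) -mulrBl mulrC.
- by move=> ch c d sch c0 chS; exact: (density_weak T n n_int n_ge0 _ _ _ _ _ _ sth sch
  a0 bT c0 thS' chS wk).
- move=> k ch c d sch c0 chS ch0.
  apply: (density_entropy T n n_int n_ge0 _ _ _ _ _ _ sth sch a0 bT c0 thS' chS k (fun t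
    => (andP (th01 t)).1) ch0 ent).
- exact: (far_flux T n n_int n_ge0 _ _ HS _ _ _ sth th01 a0 bT thS noflux).
- exact: (right_trace_weighted T n n_int n_ge0 _ _ HS _ _ _ sth th01 a0 ab bT thS g g_trace).
Qed.

Lemma total_mass_continuous t : 0 <= t -> forall e, 0 < e -> exists2 d, 0 < d &
  forall s, 0 <= s -> `|s - t| < d -> `|total_mass s - total_mass t| <= e.
Proof.
move=> t0 e e0; have [_ m_int m_cont] := m_version.
have Ht := m_cont t t0.
have fin := cvg_is_fine Ht.
have Hf : (fine \o (fun s => \int[mu]_(x in `]0%R, +oo[) `|m s x - m t x|%:E)%E) s
    @[s --> within `[0, +oo[ (nbhs t)] --> (0 : R) by exact: fine_cvg Ht.
move/cvgr0Pnorm_le: Hf => /(_ e e0) Hf.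
have [d /= d0 Hd] : \forall s \near t, `[0, +oo[%classic s ->
    (\int[mu]_(x in `]0%R, +oo[) `|m s x - m t x|%:E <= e%:E)%E.
  move: fin Hf; rewrite !near_withinE; apply: filterS2 => s fs es sI.
  by rewrite -(fineK (fs sI)) lee_fin; exact: le_trans (ler_norm _) (es sI).
exists d => // s s0 st.
have its := m_int _ s0; have itt := m_int _ t0.
have H : (\int[mu]_(x in `]0%R, +oo[) `|m s x - m t x|%:E <= e%:E)%E.
  by apply: Hd; rewrite /= ?in_itv/= ?s0// distrC.
rewrite /total_mass -(RintegralB _ its itt)// -lee_fin; apply: le_trans H.
apply: (le_trans (abse_fine_le _)); apply: le_abse_integral => //.
exact: (measurable_int mu (integrableB _ its itt)).
Qed.

Lemma mass_balance :
  (\int[mu]_(t in `[0%R, T]) (g t ^+ 2)%:E = (total_mass 0 - total_mass T)%:E)%E.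
Proof.
have [S [C HS]] := @step_function_exists R.
(* As [hseq j <= 1], the factor T / 2 ensures h + h <= T for every j, not only for large ones. *)
pose h j : R := T / 2 * hseq j.
have h0 j : 0 < h j by rewrite mulr_gt0 ?hseq_gt0// divr_gt0.
have hT j : h j + h j <= T.
  by rewrite /h -mulrDl -splitr -[leRHS]mulr1 ler_pM2l// hseq_le1.
have hlt e : 0 < e -> \forall j \near \oo, h j < e.
  move=> e0; have T2 : 0 < T / 2 by rewrite divr_gt0.
  have := near_hseq_lt _ (divr_gt0 e0 T2); apply: filterS => j.
  by rewrite ltr_pdivlMr// mulrC.
have [_ aeM] := mass_identity T n n_int n_ge0 m m_version.
have c1 : \int[mu]_t (rise' S (h j) t * M t) @[j --> \oo] --> total_mass 0.
  apply: (cvg_kernel_integral (fun j => rise' S (h j))).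
  - by move=> j; exact: integral_rise' HS _ (h0 j).
  - by move=> j t; exact: (rise'_ge0 _ _ HS).
  - by move=> j; have [] := flux_window S C (h j) HS (h0 j) (hT j).
  move=> e e0; have [d d0 Hd] := total_mass_continuous 0 (lexx 0) e e0.
  near=> j.
  apply: (@filterS _ _ (ae_filter_ringOfSetsType mu)) aeM => t Ht.
  move=> /(rise'_supp _ _ HS _ _ (h0 j))/andP[t0 th].
  have tT : t < T by apply: (lt_trans th); apply: lt_le_trans (hT j); rewrite ltrDl.
  rewrite /M Ht ?t0//; apply: Hd; first exact: ltW.
  rewrite subr0 gtr0_norm//; apply: (lt_trans th); near: j; exact: hlt.
have c2 : \int[mu]_t (rise' S (h j) (T - t) * M t) @[j --> \oo] --> total_mass T.
  apply: (cvg_kernel_integral (fun j t => rise' S (h j) (T - t))).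
  - by move=> j; exact: integral_rise'_reflect HS _ _ (h0 j) (hT j).
  - by move=> j t; exact: (rise'_ge0 _ _ HS).
  - by move=> j; have [] := flux_window S C (h j) HS (h0 j) (hT j).
  move=> e e0; have [d d0 Hd] := total_mass_continuous T (ltW T0) e e0.
  near=> j.
  apply: (@filterS _ _ (ae_filter_ringOfSetsType mu)) aeM => t Ht.
  move=> /(rise'_supp _ _ HS _ _ (h0 j))/andP[tT th].
  have t0 : 0 < t by have := h0 j; have := hT j; lra.
  move: (tT); rewrite subr_gt0 => tT'.
  rewrite /M Ht ?t0//; apply: Hd; first exact: ltW.
  rewrite distrC gtr0_norm//; apply: (lt_trans th); near: j; exact: hlt.
have cW : (fun j => \int[mu]_t (window S T (h j) t * g' t ^+ 2)%:E)%E @ \oo -->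
    (total_mass 0 - total_mass T)%:E.
  have E j : (\int[mu]_t (window S T (h j) t * g' t ^+ 2)%:E)%E =
      (\int[mu]_t (rise' S (h j) t * M t) - \int[mu]_t (rise' S (h j) (T - t) * M t))%:E.
    by have [] := flux_window S C (h j) HS (h0 j) (hT j).
  under eq_fun do rewrite E.
  by apply: cvg_EFin; [exact: nearW|exact: cvgB c1 c2].
(* Convergence here is monotone rather than dominated: integrability of g^2 is not known yet and
   results from comparing this limit with [cW]. *)
have cW' : (fun j => \int[mu]_t (window S T (h j) t * g' t ^+ 2)%:E)%E @ \oo -->
    (\int[mu]_t (g' t ^+ 2)%:E)%E.
  have g'_supp t : g' t != 0 -> 0 < t < T.
    apply: contraR => tT; rewrite patchE memNset//= in_itv/=; exact/negP.
  rewrite (_ : \int[mu]_t (g' t ^+ 2)%:E =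
      \int[mu]_t limn (fun j => (window S T (h j) t * g' t ^+ 2)%:E))%E.
    apply: cvg_monotone_convergence => //.
    - move=> j; apply/measurable_EFinP; apply: measurable_funM; last exact: measurable_funX.
      by apply: smooth_measurable; exact: smooth_window HS _ _.
    - move=> j t _; have /andP[w0 _] := window01 _ _ HS T (h j) t.
      by rewrite lee_fin mulr_ge0 ?sqr_ge0.
    (* On (0, T) the windows increase with j, because S is nondecreasing and h_j decreases;
       elsewhere g' is 0. *)
    - move=> t _ i j ij; rewrite lee_fin.
      have [->|/g'_supp/andP[t0 tT]] := eqVneq (g' t) 0; first by rewrite expr0n/= !mulr0.
      rewrite ler_wpM2r ?sqr_ge0//.
      have hij : h j <= h i by rewrite /h ler_pM2l ?divr_gt0// lef_pV2 ?posrE// ler_nat.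
      have Sij x : 0 < x -> rise S (h i) x <= rise S (h j) x.
        move=> x0; case: HS => _ homoS _ _ _; apply: homoS.
        by rewrite ler_pM2r// lef_pV2 ?posrE.
      have S0 k x : 0 <= rise S k x by have /andP[] := step01 _ _ HS (k^-1 * x).
      by apply: ler_pM => //; apply: Sij; rewrite ?subr_gt0.
  apply: eq_integral => t _; apply/esym/cvg_lim => //.
  have [E|/g'_supp/andP[t0 tT]] := eqVneq (g' t) 0.
    by apply: cvg_near_cst; near=> j; rewrite E expr0n/= mulr0.
  apply: cvg_near_cst; near=> j; congr (_%:E).
  rewrite /window !(rise1 _ _ HS)// ?mul1r//; apply: ltW; near: j; apply: hlt => //.
  by rewrite subr_gt0.
have -> : (\int[mu]_(t in `[0%R, T]) (g t ^+ 2)%:E = \int[mu]_t (g' t ^+ 2)%:E)%E.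
  have [mg _] := g_trace.
  rewrite integral_itv_bndoo; last by apply/measurable_EFinP; exact: measurable_funX.
  rewrite integral_mkcond; apply: eq_integral => t _; rewrite !patchE.
  by case: ifP => // _; rewrite expr0n.
exact: (cvg_unique _ cW' cW).
Unshelve. all: by end_near. Qed.

End mass_balance.

(** The equality is one of extended reals whose photon numbers are finite, so it includes the
    finiteness of the outflow integral. *)
Theorem proposition1p2 (R : realType) (n m : R -> R -> R) (n0 : R -> R)
    (n_sol : global_entropy_solution n)
    (n_ge0 : nonnegative n)
    (n0_L1 : (@lebesgue_measure R).-integrable `[0, +oo[ (EFin \o n0))
    (n0_supp : compactly_supported n0)
    (m_version : L1_continuous_version n m)
    (m_init : {ae @lebesgue_measure R, forall x, 0 < x -> m 0 x = n0 x})
    (T : R) (T_gt0 : 0 < T)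
    (g : R -> R) (g_trace : right_trace T n 0 g) :
  (photon_number (m T)
   + \int[@lebesgue_measure R]_(t in `[0%R, T]) (g t ^+ 2)%:E
   = photon_number n0)%E.
Proof.
have [_ m_int _] := m_version.
have mass_m t : 0 <= t -> photon_number (m t) = (total_mass m t)%:E.
  move=> t0; have it := m_int t t0.
  rewrite /photon_number -integral_itv_obnd_cbnd; last exact: (measurable_int
    lebesgue_measure it).
  by rewrite /total_mass /Rintegral fineK//; exact: (integrable_fin_num _ it).
have -> : photon_number n0 = photon_number (m 0).
  have mn0 : measurable_fun (`]0%R, +oo[ : set R) (EFin \o n0).
    apply: measurable_funS (measurable_int lebesgue_measure n0_L1) => //.
    by apply: subset_itvr; rewrite bnd_simp.
  have m0 := measurable_int lebesgue_measure (m_int 0 (lexx 0)).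
  rewrite /photon_number -!integral_itv_obnd_cbnd//.
  apply: ae_eq_integral => //.
  apply: (@filterS _ _ (ae_filter_ringOfSetsType lebesgue_measure)) m_init => x Hx.
  by rewrite /= in_itv/= andbT => /Hx ->.
rewrite !mass_m ?(ltW T_gt0)//.
rewrite (mass_balance n m T T_gt0 (n_sol T T_gt0) n_ge0 m_version g g_trace).
by rewrite -EFinD addrCA subrr addr0.
Qed.
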